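(* Let $q$ be a prime power and let $n$ be a non-trivial divisor of $q+1$ (that is, $n\mid q+1$ with $1<n<q+1$). Then there exists a normal basis $\Theta$ of $\mathbf{F}_{q^n}$ over $\mathbf{F}_q$ with complexity $O\big(n\,(\log n)\,|\log|\log n||\big)$, the constant implied by $O$ being absolute (independent of $q$ and $n$).
   Context: $\mathbf{F}_q$ denotes the finite field with $q$ elements. Let $\mathbf{L}/\mathbf{K}$ be a cyclic Galois extension of fields of degree $n$, with $\sigma$ a generator of $\mathrm{Gal}(\mathbf{L}/\mathbf{K})$. A normal basis of $\mathbf{L}$ over $\mathbf{K}$ is a $\mathbf{K}$-basis of the form $(\theta,\sigma(\theta),\ldots,\sigma^{n-1}(\theta))$ with $\theta\in\mathbf{L}^*$. Complexity: let $\Theta=(\theta_i)_{0\le i\le n-1}$ be a $\mathbf{K}$-basis of $\mathbf{L}$. Consider straight-line programs that compute the coordinates in $\Theta$ of the product $a\times b$ from the coordinates in $\Theta$ of arbitrary $a,b\in\mathbf{L}$, and that consist of additions, subtractions, multiplications of a register by a constant (in $\mathbf{K}$), and additions, subtractions, multiplications between two registers (registers hold elements of $\mathbf{K}$). The complexity of such a program is the total number of such operations. The complexity of the basis $\Theta$ is the minimal possible complexity of such a program. $\log$ denotes the natural logarithm. *)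

(* Defs.v *)
From HB Require Import structures.
From mathcomp Require Import all_boot all_order all_algebra all_fingroup.
From mathcomp Require Import all_solvable all_field.
From mathcomp Require Import reals exp.

Set Implicit Arguments.
Unset Strict Implicit.
Unset Printing Implicit Defensive.

Import Order.TTheory GRing.Theory Num.Theory.
Local Open Scope ring_scope.

(* Registers are numbered by nat.  A program never overwrites a register: each
   instruction writes its result to the first unused one, so that after t
   instructions on m inputs exactly the registers 0, ..., m + t - 1 are in use.
   Up to renaming registers, this is no restriction and changes no operation
   count. *)
Inductive instr (K : Type) : Type :=
| AddC of nat & K
| SubC of nat & K
| MulC of nat & K
| Add of nat & nat
| Sub of nat & nat
| Mul of nat & nat.

Definition exec (K : pzRingType) (mem : seq K) (i : instr K) : K :=
  match i with
  | AddC r c => mem`_r + c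
  | SubC r c => mem`_r - c
  | MulC r c => mem`_r * c
  | Add r s => mem`_r + mem`_s
  | Sub r s => mem`_r - mem`_s
  | Mul r s => mem`_r * mem`_s
  end.

Definition run (K : pzRingType) (code : seq (instr K)) (mem : seq K) : seq K :=
  foldl (fun mem i => rcons mem (exec mem i)) mem code.

(* [output] lists the registers in which the results are read, at no cost. *)
Record slp (K : Type) : Type := Slp { code : seq (instr K); output : seq nat }.

Definition slp_eval (K : pzRingType) (P : slp K) (input : seq K) : seq K :=
  [seq (run (code P) input)`_r | r <- output P].

Definition slp_cost (K : Type) (P : slp K) : nat := size (code P).

Definition instr_wf (K : Type) (m : nat) (i : instr K) : bool :=
  match i with
  | AddC r _ | SubC r _ | MulC r _ => (r < m)%N
  | Add r s | Sub r s | Mul r s => (r < m)%N && (s < m)%N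
  end.

Fixpoint code_wf (K : Type) (m : nat) (code : seq (instr K)) : bool :=
  if code is i :: code' then instr_wf m i && code_wf m.+1 code' else true.

(* Only registers already in use are read; in particular the default value 0
   of [nth] in [exec] and [slp_eval] is never used. *)
Definition slp_wf (K : Type) (m : nat) (P : slp K) : bool :=
  code_wf m (code P) && all (fun r => r < m + size (code P))%N (output P).

Definition coords (K : fieldType) (L : fieldExtType K) (n : nat)
    (Theta : n.-tuple L) (a : L) : seq K :=
  [seq coord Theta i a | i <- enum 'I_n].

Definition computes_product (K : fieldType) (L : fieldExtType K) (n : nat)
    (Theta : n.-tuple L) (P : slp K) : Prop :=
  slp_wf (n + n) P /\
  forall a b : L,
    slp_eval P (coords Theta a ++ coords Theta b) = coords Theta (a * b).

Definition is_complexity (K : fieldType) (L : fieldExtType K) (n : nat)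
    (Theta : n.-tuple L) (c : nat) : Prop :=
  (exists2 P : slp K, computes_product Theta P & slp_cost P = c) /\
  forall P : slp K, computes_product Theta P -> (c <= slp_cost P)%N.

Definition is_normal_basis (K : fieldType) (L : splittingFieldType K)
    (sigma : gal_of {:L}) (n : nat) (Theta : n.-tuple L) : Prop :=
  basis_of {:L} Theta /\
  exists2 theta : L, theta != 0 &
    Theta = [tuple (sigma ^+ i)%g theta | i < n].

(* Main.v *)
Require Import Defs.
From HB Require Import structures.
From mathcomp Require Import all_boot all_order all_algebra all_fingroup.
From mathcomp Require Import all_solvable all_field.
From mathcomp Require Import reals exp.
From mathcomp Require Import boolp zify ring lra.

Set Implicit Arguments.
Unset Strict Implicit.
Unset Printing Implicit Defensive.

Import Order.TTheory GRing.Theory Num.Theory.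
Local Open Scope ring_scope.

(** Write [q] for the order of [K] and let [L] be its extension of degree [n].

    The basis.  The quotient of the multiplicative group of the field of order
    [q^2] by that of [K] is cyclic of order [q + 1], so it has an element [g]
    of order [n]; multiplication by [g] acts on the projective line as a
    homography defined over [K], of order [n], with no fixed point over [K].
    The points on which Frobenius acts as this homography are the roots of a
    polynomial of degree [q + 1], and its roots lie in [L]
    ([exists_homography_root]).  Any such [theta] has its conjugates
    as homographic images, and clearing the denominator gives, for distinct
    conjugates,
      [theta_i theta_j = h theta_i - (tau + h) theta_j - nu]
    with [h] in [K] depending on [j - i] only ([exists_homography_fixpoint]).
    This is the addition formula
      [cot x cot y = cot (y - x) (cot x - cot y) - 1].
    Consequently the traces of [theta_i theta_j], for [i <> j], all coincide.
    Translate [theta] so that its trace is 1, and let [b] be the common value: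
    the Gram matrix of the conjugates under the trace form is then
    [(1 - n b) I + b J], where [J] has all its entries equal to 1.  As [n] is
    prime to [q], and as [1 - n b] is [n^2] times a value of the minimal
    polynomial of [g], the conjugates form a basis ([exists_normal_element]).

    The product.  The terms [i <> j] of the product of two elements are
    expanded by the addition formula, and the squares by the coordinates of
    one square.  Everything depends on differences of indices, so that a
    product of coordinate vectors costs three cyclic convolutions of length
    [n] by constant vectors and O(n) further operations ([product_formula]).

    The convolutions.  They reduce to multiplying polynomials, which the
    method of Schoenhage and Strassen does in O(n log n loglog n) operations
    over every field: the missing roots of unity are provided by the powers
    of [X] in the algebra of polynomials modulo [1 + X^t + ... + X^(t (R-1))].
    The radix [R] has to be invertible, and [R = 2] or [R = 3] will do.  With
    [m = R^k], a product modulo [1 + X^m + ... + X^(m (R-1))] reduces to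
    about [R^(k/2)] products of the same kind, of half the exponent and of
    twice the total size, plus O(k m) additions ([mulmod_step]).  Divided by
    [m], the cost thus satisfies [f(k) <= 2 f(k/2) + O(k)], whence
    [f(k) = O(k log k)] ([mulmod_fast]).

    The programs.  Costs are counted on lists of values already computed in
    a commutative [K]-algebra [V].  Statements about polynomials over [V] then
    describe computations, and a program is extracted only once, when [V] is
    the ring of functions of the [2 n] input coordinates
    ([compile_reaches]). *)

(** * Values computed within a given cost *)

Section Calculus.

Variables (K : fieldType) (V : comNzRingType) (iota : {rmorphism K -> V}).
Implicit Types (M p q : {poly V}) (S : seq V).

Inductive step (S : seq V) : V -> Prop :=
| StepAddC a c of a \in S : step S (a + iota c)
| StepSubC a c of a \in S : step S (a - iota c)
| StepMulC a c of a \in S : step S (a * iota c)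
| StepAdd a b of a \in S & b \in S : step S (a + b)
| StepSub a b of a \in S & b \in S : step S (a - b)
| StepMul a b of a \in S & b \in S : step S (a * b).

Inductive grows : nat -> seq V -> seq V -> Prop :=
| Grows0 S : grows 0 S S
| GrowsS c S S' v of grows c S S' & step S' v : grows c.+1 S (rcons S' v).

(** Values are added and never removed, so that goals monotone in the list of
    known values compose, with costs adding up; keeping [c] a mere bound spares
    exact counts. *)
Definition reaches c S (G : seq V -> Prop) :=
  exists c' S', [/\ (c' <= c)%N, grows c' S S' & G S'].

Definition mono (G : seq V -> Prop) :=
  forall S S', {subset S <= S'} -> G S -> G S'.

Lemma grows_sub c S S' : grows c S S' -> {subset S <= S'}.
Proof.
elim=> [S0 x //|c0 S0 S1 v _ IH _ x /IH xS1].
by rewrite mem_rcons inE xS1 orbT.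
Qed.

Lemma grows_trans c d S1 S2 S3 :
  grows c S1 S2 -> grows d S2 S3 -> grows (c + d) S1 S3.
Proof.
move=> g12 g23; elim: g23 g12 => [S|{}d S S' v _ IH st] g12.
  by rewrite addn0.
by rewrite addnS; apply: GrowsS st; apply: IH.
Qed.

Lemma reaches_now c S G : G S -> reaches c S G.
Proof. by move=> GS; exists 0, S; split=> //; apply: Grows0. Qed.

Lemma reaches_bind c d S (G H : seq V -> Prop) :
  reaches c S G ->
  (forall S', {subset S <= S'} -> G S' -> reaches d S' H) ->
  reaches (c + d) S H.
Proof.
move=> [c' [S' [le_c g GS']]] /(_ S' (grows_sub g) GS').
move=> [d' [S'' [le_d g' HS'']]].
exists (c' + d')%N, S''; split=> //; first exact: leq_add.
exact: grows_trans g g'.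
Qed.

Lemma reaches_weaken c d S (G H : seq V -> Prop) :
  (c <= d)%N -> (forall S', {subset S <= S'} -> G S' -> H S') ->
  reaches c S G -> reaches d S H.
Proof.
move=> le_cd GH [c' [S' [le_c g GS']]]; exists c', S'.
by split=> //; [apply: leq_trans le_cd | apply: GH GS'; apply: grows_sub g].
Qed.

(** The body has to succeed from every extension of [S], since the previous
    iterations have added values to [S]. *)
Lemma reaches_loop n (c : nat -> nat) S (G : nat -> seq V -> Prop) :
  (forall i, mono (G i)) ->
  (forall i S', (i < n)%N -> {subset S <= S'} -> reaches (c i) S' (G i)) ->
  reaches (\sum_(i < n) c i) S (fun S' => forall i, (i < n)%N -> G i S').
Proof.
move=> monoG; elim: n => [|n IHn] reachG; first exact: reaches_now.
rewrite big_ord_recr /=; apply: reaches_bind.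
  by apply: IHn => i S' lt_in; apply: reachG; apply: ltnW.
move=> S' sSS' GS'.
apply: (reaches_weaken (leqnn _) _ (reachG n S' (ltnSn n) sSS')).
move=> S'' sS'S'' GnS'' i; rewrite ltnS leq_eqVlt => /predU1P[-> //|lt_in].
exact: monoG sS'S'' (GS' i lt_in).
Qed.

Lemma reaches_nloop n c S (G : nat -> seq V -> Prop) :
  (forall i, mono (G i)) ->
  (forall i S', (i < n)%N -> {subset S <= S'} -> reaches c S' (G i)) ->
  reaches (n * c) S (fun S' => forall i, (i < n)%N -> G i S').
Proof.
move=> monoG reachG; have := reaches_loop monoG reachG.
by rewrite sum_nat_const card_ord.
Qed.

Lemma mono_mem v : mono (fun S => v \in S).
Proof. by move=> S S' sSS' /sSS'. Qed.

Lemma reaches_step S v : step S v -> reaches 1 S (fun S' => v \in S').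
Proof.
move=> st; exists 1, (rcons S v); split=> //; last by rewrite mem_rcons mem_head.
by apply: GrowsS st; apply: Grows0.
Qed.

Lemma reaches_add S a b :
  a \in S -> b \in S -> reaches 1 S (fun S' => a + b \in S').
Proof. by move=> aS bS; apply: reaches_step; apply: StepAdd. Qed.

Lemma reaches_sub S a b :
  a \in S -> b \in S -> reaches 1 S (fun S' => a - b \in S').
Proof. by move=> aS bS; apply: reaches_step; apply: StepSub. Qed.

Lemma reaches_mul S a b :
  a \in S -> b \in S -> reaches 1 S (fun S' => a * b \in S').
Proof. by move=> aS bS; apply: reaches_step; apply: StepMul. Qed.

Lemma reaches_scale S a c :
  a \in S -> reaches 1 S (fun S' => a * iota c \in S').
Proof. by move=> aS; apply: reaches_step; apply: StepMulC. Qed.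

Lemma reaches_const S c : 0 \in S -> reaches 1 S (fun S' => iota c \in S').
Proof.
by move=> S0; rewrite -[iota c]add0r; apply: reaches_step; apply: StepAddC.
Qed.

Lemma reaches_sum n c S (f : nat -> V) : 0 \in S ->
  (forall i S', (i < n)%N -> {subset S <= S'} ->
     reaches c S' (fun S'' => f i \in S'')) ->
  reaches (n * c.+1) S (fun S' => \sum_(i < n) f i \in S').
Proof.
move=> S0; elim: n => [|n IHn] reachf.
  by apply: reaches_now; rewrite big_ord0.
rewrite big_ord_recr mulSnr /=; apply: reaches_bind.
  by apply: IHn => i S' lt_in; apply: reachf; apply: ltnW.
move=> S' sSS' sumS'; rewrite -addn1; apply: reaches_bind.
  exact: reachf (ltnSn n) sSS'.
by move=> S'' sS'S'' fS''; apply: reaches_add fS''; apply: sS'S''.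
Qed.

(** * Polynomials with known coefficients *)

Definition coefs_in (p : {poly V}) (S : seq V) := forall i, p`_i \in S.

Lemma mono_coefs_in p : mono (coefs_in p).
Proof. by move=> S S' sSS' pS i; apply: sSS'. Qed.

Lemma reaches_coefs n c S (p : {poly V}) : 0 \in S -> (size p <= n)%N ->
  (forall i S', (i < n)%N -> {subset S <= S'} ->
     reaches c S' (fun S'' => p`_i \in S'')) ->
  reaches (n * c) S (coefs_in p).
Proof.
move=> S0 le_pn reachp; have mono_p i := @mono_mem p`_i.
have := reaches_nloop mono_p reachp; apply: reaches_weaken => // S' sSS' pS' i.
have [/pS' //|le_ni] := ltnP i n.
by rewrite nth_default ?sSS' //; apply: leq_trans le_ni.
Qed.

(** Congruence by an explicit multiple: over the ring [V], which has zero
    divisors in the application, no division of polynomials is involved. *)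
Definition pcong (M p q : {poly V}) := exists d, p = q + d * M.

Lemma pcong_refl M p : pcong M p p.
Proof. by exists 0; rewrite mul0r addr0. Qed.

Lemma pcong_sym M p q : pcong M p q -> pcong M q p.
Proof. by move=> [d ->]; exists (- d); rewrite mulNr addrK. Qed.

Lemma pcong_trans M q p u : pcong M p q -> pcong M q u -> pcong M p u.
Proof. by move=> [d ->] [e ->]; exists (e + d); rewrite mulrDl addrA. Qed.

Lemma pcongD M p q p' q' :
  pcong M p q -> pcong M p' q' -> pcong M (p + p') (q + q').
Proof. by move=> [d ->] [e ->]; exists (d + e); ring. Qed.

Lemma pcongN M p q : pcong M p q -> pcong M (- p) (- q).
Proof. by move=> [d ->]; exists (- d); ring. Qed.

Lemma pcongM M p q p' q' :
  pcong M p q -> pcong M p' q' -> pcong M (p * p') (q * q').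
Proof.
by move=> [d ->] [e ->]; exists (d * q' + e * q + d * e * M); ring.
Qed.

Lemma pcongMl M u p q : pcong M p q -> pcong M (u * p) (u * q).
Proof. exact/pcongM/pcong_refl. Qed.

Lemma pcongX M p q n : pcong M p q -> pcong M (p ^+ n) (q ^+ n).
Proof.
move=> pq; elim: n => [|n IHn]; first exact: pcong_refl.
by rewrite !exprS; apply: pcongM.
Qed.

Lemma pcong_sum M (I : Type) (r : seq I) (P : pred I) (F G : I -> {poly V}) :
  (forall i, P i -> pcong M (F i) (G i)) ->
  pcong M (\sum_(i <- r | P i) F i) (\sum_(i <- r | P i) G i).
Proof.
move=> FG; apply: big_ind2 => //; first exact: pcong_refl.
by move=> *; apply: pcongD.
Qed.

Lemma pcong_eq M p q : p = q -> pcong M p q.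
Proof. by move->; apply: pcong_refl. Qed.

(** The bound [n] need not be the degree of [M]: letting representatives have
    [t R] coefficients, rather than [t (R - 1)], modulo [Phi R t] makes the
    multiplication by powers of [X] a mere rotation. *)
Definition known (M : {poly V}) n p (S : seq V) :=
  exists p' : {poly V}, [/\ (size p' <= n)%N, pcong M p' p & coefs_in p' S].

Lemma mono_known M n p : mono (known M n p).
Proof.
by move=> S S' sSS' [p' [? ? pS]]; exists p'; split=> // i; apply: sSS'.
Qed.

Lemma known_cong M n p q S : pcong M p q -> known M n p S -> known M n q S.
Proof.
move=> pq [p' [? p'p ?]]; exists p'; split=> //; exact: pcong_trans p'p pq.
Qed.

Lemma known_coefs M n p S : (size p <= n)%N -> coefs_in p S -> known M n p S.
Proof. by exists p; split=> //; apply: pcong_refl. Qed.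

Lemma coefs_in0 p n S : coefs_in p S -> (size p <= n)%N -> 0 \in S.
Proof. by move=> pS /(nth_default 0) <-. Qed.

Lemma known0 M n S : 0 \in S -> known M n 0 S.
Proof.
by move=> S0; apply: known_coefs; rewrite ?size_poly0 // => i; rewrite coef0.
Qed.

Lemma reaches_known_add M n p q S : known M n p S -> known M n q S ->
  reaches n S (known M n (p + q)).
Proof.
move=> [p' [sp cp pS]] [q' [sq cq qS]]; have S0 := coefs_in0 pS sp.
have sz: (size (p' + q')%R <= n)%N.
  by rewrite (leq_trans (size_polyD _ _)) // geq_max sp.
rewrite -[n in reaches n]muln1.
apply: (reaches_weaken (leqnn _) _ (reaches_coefs (c := 1) S0 sz _)).
  by move=> S' _ H; exists (p' + q'); split=> //; apply: pcongD.
by move=> i S' _ sSS'; rewrite coefD; apply: reaches_add; apply: sSS'.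
Qed.

Lemma reaches_known_sub M n p q S : known M n p S -> known M n q S ->
  reaches n S (known M n (p - q)).
Proof.
move=> [p' [sp cp pS]] [q' [sq cq qS]]; have S0 := coefs_in0 pS sp.
have sz: (size (p' - q')%R <= n)%N.
  by rewrite (leq_trans (size_polyD _ _)) // size_polyN geq_max sp.
rewrite -[n in reaches n]muln1.
apply: (reaches_weaken (leqnn _) _ (reaches_coefs (c := 1) S0 sz _)).
  by move=> S' _ H; exists (p' - q'); split=> //; apply/pcongD/pcongN.
by move=> i S' _ sSS'; rewrite coefB; apply: reaches_sub; apply: sSS'.
Qed.

Lemma reaches_known_scale M n p c S : known M n p S ->
  reaches n S (known M n ((iota c)%:P * p)).
Proof.
move=> [p' [sp cp pS]]; have S0 := coefs_in0 pS sp.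
have sz: (size ((iota c)%:P * p')%R <= n)%N.
  by rewrite mul_polyC (leq_trans (size_scale_leq _ _)).
rewrite -[n in reaches n]muln1.
apply: (reaches_weaken (leqnn _) _ (reaches_coefs (c := 1) S0 sz _)).
  by move=> S' _ H; exists ((iota c)%:P * p'); split=> //; apply: pcongMl.
by move=> i S' _ sSS'; rewrite coefCM mulrC; apply: reaches_scale; apply: sSS'.
Qed.

Lemma reaches_known_sum M n m (F : nat -> {poly V}) S : 0 \in S ->
  (forall i, (i < m)%N -> known M n (F i) S) ->
  reaches (m * n) S (known M n (\sum_(i < m) F i)).
Proof.
move=> S0; elim: m => [|m IHm] kF.
  by apply: reaches_now; rewrite big_ord0; apply: known0.
rewrite big_ord_recr mulSnr /=; apply: reaches_bind.
  by apply: IHm => i lt_im; apply: kF; apply: ltnW.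
move=> S' sSS' kS'; apply: reaches_known_add => //.
exact: mono_known sSS' (kF m _).
Qed.

Lemma reaches_naive_mul n p q S : 0 \in S ->
  (size p <= n)%N -> (size q <= n)%N -> coefs_in p S -> coefs_in q S ->
  reaches ((n + n) * ((n + n) * 2)) S (coefs_in (p * q)).
Proof.
move=> S0 sp sq pS qS; apply: reaches_coefs => //.
  by rewrite (leq_trans (size_polyMleq _ _)) // (leq_trans (leq_pred _)) ?leq_add.
move=> i S' lt_i sSS'; rewrite coefM.
have reach_sum : reaches (i.+1 * 2) S'
    (fun S'' => \sum_(j < i.+1) p`_j * q`_(i - j) \in S'').
  apply: (@reaches_sum _ _ _ (fun j => p`_j * q`_(i - j))); first exact: sSS'.
  by move=> j S'' _ sS'; apply: reaches_mul; apply/sS'/sSS'.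
by apply: reaches_weaken reach_sum => //; rewrite leq_mul2r.
Qed.

End Calculus.

(** * Cutting polynomials into blocks *)

Section Blocks.

Variable V : comNzRingType.
Implicit Types (M p q : {poly V}) (S : seq V).

Lemma big_ord_mul (W : Type) (idx : W) (op : Monoid.com_law idx) a b f :
  \big[op/idx]_(i < a * b) f (i : nat) =
  \big[op/idx]_(x < a) \big[op/idx]_(y < b) f (a * y + x)%N.
Proof.
rewrite exchange_big /= -(big_mkord xpredT f).
elim: b => [|b IHb]; first by rewrite muln0 big_geq // big_ord0.
rewrite big_ord_recr /= -IHb (@big_cat_nat _ _ _ (a * b)) ?leq_mul2l ?leqnSn
  ?orbT //=.
congr (op _ _); rewrite mulnS addnC -{1}[(a * b)%N]add0n big_addn addKn big_mkord.
by apply: eq_bigr => i _; rewrite addnC.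
Qed.

(** Blocks of size at most [s] put side by side do not overlap: reading and
    concatenating blocks moves registers around without any operation. *)
Lemma coef_blocks s D (c : nat -> {poly V}) j : (0 < s)%N ->
  (forall i, (i < D)%N -> (size (c i) <= s)%N) ->
  (\sum_(i < D) 'X^(s * i) * c i)`_j =
    if (j < s * D)%N then (c (j %/ s)%N)`_(j %% s)%N else 0.
Proof.
move=> s0 sz; rewrite coef_sum.
have E (i : 'I_D) : ('X^(s * i) * c i)`_j =
    if i == (j %/ s)%N :> nat then (c (j %/ s)%N)`_(j %% s)%N else 0.
  rewrite coefXnM; have dE := divn_eq j s; have mE := ltn_pmod j s0.
  case: ltnP => [lt_j|le_j].
    by case: eqP => // iE; exfalso; rewrite iE in lt_j; lia.
  case: eqP => [->|ne]; first by congr (_`_ _); lia.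
  apply: nth_default; apply: leq_trans (sz i (ltn_ord i)) _.
  suff: (i < j %/ s)%N by nia.
  by rewrite ltn_neqAle leq_divRL // mulnC le_j andbT; apply/eqP.
rewrite (eq_bigr _ (fun i _ => E i)).
case: ltnP => [lt_j|le_j].
  have lt_d : (j %/ s < D)%N by rewrite ltn_divLR // mulnC.
  rewrite (bigD1 (Ordinal lt_d)) //= eqxx big1 ?addr0 // => i.
  by rewrite -val_eqE /= => /negPf ->.
apply: big1 => i _; case: eqP => // iE; exfalso.
by have := ltn_ord i; rewrite iE ltn_divLR // mulnC ltnNge le_j.
Qed.

Lemma size_blocks s D (c : nat -> {poly V}) : (0 < s)%N ->
  (forall i, (i < D)%N -> (size (c i) <= s)%N) ->
  (size (\sum_(i < D) 'X^(s * i) * c i)%R <= s * D)%N.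
Proof.
move=> s0 sz; apply/leq_sizeP => j le_j.
by rewrite coef_blocks // ltnNge le_j.
Qed.

Lemma coefs_in_blocks s D (c : nat -> {poly V}) S : (0 < s)%N -> 0 \in S ->
  (forall i, (i < D)%N -> (size (c i) <= s)%N) ->
  (forall i, (i < D)%N -> coefs_in (c i) S) ->
  coefs_in (\sum_(i < D) 'X^(s * i) * c i) S.
Proof.
move=> s0 S0 sz cS j; rewrite coef_blocks //.
by case: ltnP => // lt_j; apply: cS; rewrite ltn_divLR // mulnC.
Qed.

Definition block s p i : {poly V} := \poly_(l < s) p`_(s * i + l).

Lemma size_block s p i : (size (block s p i) <= s)%N.
Proof. exact: size_poly. Qed.

Lemma coefs_in_block s p i S : 0 \in S -> coefs_in p S ->
  coefs_in (block s p i) S.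
Proof. by move=> S0 pS j; rewrite coef_poly; case: ifP. Qed.

Lemma blockE s D p : (0 < s)%N -> (size p <= s * D)%N ->
  p = \sum_(i < D) 'X^(s * i) * block s p i.
Proof.
move=> s0 sz; apply/polyP => j.
rewrite coef_blocks //; last by move=> i _; apply: size_block.
case: ltnP => [_|le_j]; last by rewrite nth_default // (leq_trans sz).
by rewrite coef_poly ltn_pmod // mulnC -divn_eq.
Qed.

(** * The modulus *)

(** For [r] prime this is the [r]-th cyclotomic polynomial at [X^t]; modulo it,
    [X^t] plays the part of a primitive [r]-th root of unity. *)
Definition Phi r t : {poly V} := \sum_(i < r) 'X^(t * i).

Lemma Phi_geom r t : ('X^t - 1) * Phi r t = 'X^(t * r) - 1.
Proof.
rewrite exprM [RHS]subrX1; congr (_ * _).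
by apply: eq_bigr => i _; rewrite exprM.
Qed.

Lemma pcong_Phi1 r t : pcong (Phi r t) 'X^(t * r) 1.
Proof. by exists ('X^t - 1); rewrite Phi_geom; ring. Qed.

Lemma pcong_Phi_exp r t a b : a = b %[mod t * r] ->
  pcong (Phi r t) 'X^a 'X^b.
Proof.
have key c : pcong (Phi r t) 'X^c 'X^(c %% (t * r)).
  rewrite {1}(divn_eq c (t * r)) exprD mulnC exprM -[X in pcong _ _ X]mul1r.
  apply: pcongM (pcong_refl _ _); rewrite -[1](expr1n _ (c %/ (t * r))).
  exact/pcongX/pcong_Phi1.
by move=> ab; apply: pcong_trans (key a) _; rewrite ab; apply/pcong_sym/key.
Qed.

Lemma Phi_recr r t : Phi r.+1 t = Phi r t + 'X^(t * r).
Proof. by rewrite /Phi big_ord_recr. Qed.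

Lemma size_Phi r t : (0 < t)%N -> size (Phi r.+1 t) = (t * r).+1.
Proof.
move=> t0; rewrite Phi_recr addrC size_polyDl size_polyXn // ltnS.
case: r => [|r]; first by rewrite /Phi big_ord0 size_poly0.
rewrite /Phi; apply: leq_trans (size_sum _ _ _) _; apply/bigmax_leqP => i _.
by rewrite size_polyXn ltn_mul2l t0 /=.
Qed.

Lemma monic_Phi r t : (0 < t)%N -> Phi r.+1 t \is monic.
Proof.
move=> t0; rewrite monicE /lead_coef size_Phi //= Phi_recr coefD coefXn eqxx.
rewrite nth_default ?add0r //.
case: r => [|r]; first by rewrite /Phi big_ord0 size_poly0.
by rewrite size_Phi // ltn_mul2l t0 /=.
Qed.

Lemma pcong_Phi_uniq r t p q : (0 < t)%N ->
  (size p <= t * r)%N -> (size q <= t * r)%N ->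
  pcong (Phi r.+1 t) p q -> p = q.
Proof.
move=> t0 sp sq [d pE]; have [d0|dn0] := eqVneq d 0.
  by rewrite pE d0 mul0r addr0.
have: (size (d * Phi r.+1 t)%R <= t * r)%N.
  have -> : d * Phi r.+1 t = p - q by rewrite pE; ring.
  by rewrite (leq_trans (size_polyD _ _)) // size_polyN geq_max sp.
rewrite size_Mmonic ?monic_Phi // size_Phi // addnS /=.
by rewrite -{2}[(t * r)%N]add0n leq_add2r leqNgt size_poly_gt0 dn0.
Qed.

(** Modulo [Phi r t] one has [r = - (Y - 1) B] with [Y = X^t], because
    [Y^k - 1] summed over [k < r] is [Phi r t - r]; and [Y^e - 1] divides
    [Y^(e e') - 1], congruent to [Y - 1] for [e'] inverse to [e] modulo [r].
    This replaces [1 - zeta <> 0] for a genuine root of unity [zeta]. *)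
Lemma pcong_Phi_unit r t e : (0 < r)%N -> coprime r e ->
  exists g, pcong (Phi r t) (g * ('X^(t * e) - 1)) r%:R.
Proof.
move=> r0 cop.
have [e' e'E] : exists e', (e * e' = 1 %[mod r])%N.
  have e0 : (0 < e)%N \/ r = 1%N.
    by case: e cop => [|e]; [rewrite /coprime gcdn0 => /eqP; right | left].
  case: e0 => [e0|->]; last by exists 0; rewrite !modn1.
  have [u v uE _] := egcdnP r e0; exists u.
  by rewrite mulnC uE gcdnC (eqP cop) modnMDl.
exists (- (\sum_(i < e') ('X^(t * e)) ^+ i)
  * \sum_(k < r) \sum_(i < k) 'X^(t * i)).
have divE : ('X^(t * e) - 1) * (\sum_(i < e') ('X^(t * e)) ^+ i)
    = 'X^(t * (e * e')) - 1 :> {poly V}.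
  by rewrite mulnA [in RHS]exprM [RHS]subrX1.
set A := \sum_(i < e') _ in divE *; set B := \sum_(k < r) _.
have -> : - A * B * ('X^(t * e) - 1) = - (('X^(t * (e * e')) - 1) * B).
  by rewrite -divE; ring.
apply: (@pcong_trans _ _ (- (('X^t - 1) * B))).
  apply: pcongN; apply: pcongM (pcong_refl _ _); apply: pcongD (pcong_refl _ _).
  apply: pcong_Phi_exp; rewrite -[X in _ = X %[mod _]]muln1.
  by rewrite -!muln_modr e'E.
have BE : ('X^t - 1) * B = Phi r t - r%:R.
  rewrite /B mulr_sumr /Phi -[r in r%:R]card_ord -sumr_const -sumrB.
  apply: eq_bigr => k _; rewrite exprM [RHS]subrX1; congr (_ * _).
  by apply: eq_bigr => i _; rewrite exprM.
by rewrite BE; exists (- 1); ring.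
Qed.

(** [X^w] is a principal root of unity of order [r^(h+1)].  The geometric sum
    is killed by [X^(w d) - 1], hence by its multiple [X^(t d') - 1], where
    [d'] is the part of [d] prime to [r]; and the latter divides [r], which is
    invertible. *)
Lemma principal_root r h w d rho : prime r -> r%:R * rho = 1 :> V ->
  ~~ (r ^ h.+1 %| d)%N ->
  pcong (Phi r (w * r ^ h)) (\sum_(j < r ^ h.+1) 'X^(w * d * j)) 0.
Proof.
move=> r_pr rho1 ndvd; set t := (w * r ^ h)%N.
have d0 : (0 < d)%N by case: d ndvd => //; rewrite dvdn0.
have [d' cop dE] := pfactor_coprime r_pr d0; set b := logn r d in dE.
have le_bh : (b <= h)%N.
  rewrite leqNgt; apply: contra ndvd => lt_hb.
  by rewrite dE dvdn_mull // dvdn_exp2l.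
have [g gE] := pcong_Phi_unit t (prime_gt0 r_pr) cop.
set G := \sum_(j < _) _.
have keyG : pcong (Phi r t) (('X^(t * d') - 1) * G) 0.
  pose y : {poly V} := 'X^(w * d).
  have -> : G = \sum_(j < r ^ h.+1) y ^+ j.
    by apply: eq_bigr => j _; rewrite -exprM.
  have -> : 'X^(t * d') = y ^+ (r ^ (h - b)).
    by rewrite -exprM; congr ('X^_); rewrite dE /t -{1}(subnK le_bh) expnD; ring.
  rewrite subrX1 -mulrA mulrCA -subrX1 /y -!exprM.
  rewrite -[X in pcong _ _ X](mulr0 (\sum_(i < r ^ (h - b)) y ^+ i)).
  apply: pcongMl.
  rewrite -(subrr 1); apply: pcongD (pcong_refl _ _).
  rewrite -(expr0 'X); apply: pcong_Phi_exp.
  rewrite mod0n /t expnSr -mulnA -mulnA [(d * _)%N]mulnC !mulnA.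
  by rewrite modnMr.
have: pcong (Phi r t) (rho%:P * (r%:R * G)) 0.
  rewrite -[X in pcong _ _ X](mulr0 rho%:P); apply: pcongMl.
  apply: (@pcong_trans _ _ (g * ('X^(t * d') - 1) * G)).
    by apply: pcongM (pcong_refl _ _); apply: pcong_sym.
  by rewrite -mulrA -[X in pcong _ _ X](mulr0 g); apply: pcongMl.
by rewrite mulrA -(rmorph_nat (polyC : {rmorphism V -> {poly V}})) -rmorphM /=
  mulrC [rho * _]mulrC rho1 mulr1.
Qed.

End Blocks.

(** * One step of the recursion *)

Section Transform.

Variables (K : fieldType) (V : comNzRingType) (iota : {rmorphism K -> V}).
Variable r : nat.
Implicit Types (M p q : {poly V}) (S : seq V).
Local Notation R := r.+1.
Local Notation reaches := (reaches iota).

Lemma known_rot t j p S : (0 < t)%N ->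
  known (Phi V R t) (t * R) p S -> known (Phi V R t) (t * R) ('X^j * p) S.
Proof.
move=> t0; elim: j => [|j IHj] kp; first by rewrite mul1r.
have [p' [sz cp pS]] := IHj kp; have S0 := coefs_in0 pS sz.
rewrite exprS -mulrA; set L := (t * R)%N in sz *.
have L0 : (0 < L)%N by rewrite muln_gt0 t0.
pose u := 'X * p' - p'`_L.-1 *: ('X^L - 1).
have uE i : u`_i = if (i < L)%N then (if i is i'.+1 then p'`_i' else p'`_L.-1) else 0.
  rewrite coefB coefXM coefZ coefB coefXn coef1.
  case: i => [|i] /=.
    by rewrite L0 (ltn_eqF L0) mulr0n !sub0r mulrN1 opprK.
  case: (ltngtP i.+1 L) => [lt_i|lt_i|<-] /=.
  - by rewrite subr0 mulr0 subr0.
  - by rewrite nth_default ?subr0 ?mulr0 ?subr0 //; apply: leq_trans sz _.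
  by rewrite subr0 mulr1 subrr.
exists u; split.
- by apply/leq_sizeP => i le_i; rewrite uE ltnNge le_i.
- apply: pcong_trans (pcongMl _ cp); exists (- p'`_L.-1 *: ('X^t - 1)).
  by rewrite -scalerAl Phi_geom /u scaleNr.
- by move=> i; rewrite uE; case: ifP => //; case: i.
Qed.

(** The coefficients of [X^(t r + i)], for [i < t], are cancelled by subtracting
    multiples of [Phi]: one subtraction for each remaining coefficient. *)
Lemma reaches_reduce t p S : (0 < t)%N ->
  known (Phi V R t) (t * R) p S ->
  reaches (t * R) S (known (Phi V R t) (t * r) p).
Proof.
move=> t0 [p' [sz cp pS]]; have S0 := coefs_in0 pS sz.
pose u := p' - \sum_(i < R) 'X^(t * i) * block t p' r.
have uE i : u`_i = if (i < t * r)%N then p'`_i - p'`_(t * r + i %% t) else 0.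
  rewrite coefB (@coef_blocks _ _ _ (fun=> block t p' r)) //; last first.
    by move=> *; apply: size_block.
  rewrite coef_poly ltn_pmod //.
  have [lt_i|le_i] := ltnP i (t * r).
    by rewrite (leq_trans lt_i) // leq_mul2l leqnSn orbT.
  have [lt_i|le_i'] := ltnP i (t * R); last first.
    by rewrite nth_default ?subr0 // (leq_trans sz).
  suff -> : (t * r + i %% t)%N = i by rewrite subrr.
  have dE : (i %/ t)%N = r.
    by apply/eqP; rewrite eqn_leq leq_divRL // mulnC le_i -ltnS ltn_divLR //
      mulnC lt_i.
  by rewrite {2}(divn_eq i t) dE mulnC.
have szu : (size u <= t * r)%N.
  by apply/leq_sizeP => i le_i; rewrite uE ltnNge le_i.
have reach_u : reaches ((t * r) * 1) S (coefs_in u).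
  apply: reaches_coefs => // i S' lt_i sSS'; rewrite uE lt_i.
  by apply: reaches_sub; apply: sSS'; apply: pS.
apply: reaches_weaken reach_u; first by rewrite muln1 leq_mul2l leqnSn orbT.
move=> S' sSS' uS'; exists u; split=> //; apply: pcong_trans cp.
by exists (- block t p' r); rewrite /u -mulr_suml mulNr [_ * Phi _ _ _]mulrC.
Qed.

(** Radix-[R] fast Fourier transform with root of unity [X^w]: splitting the
    indices by their residues modulo [R] leaves [R] transforms with root of
    unity [X^(w R)].  Only additions are paid, and the result is stated for
    all [j] since it is periodic in [j] up to congruence. *)
Lemma reaches_dft t h w (a : nat -> {poly V}) S : (0 < t)%N ->
  (t * R %| w * R ^ h)%N ->
  (forall i, (i < R ^ h)%N -> known (Phi V R t) (t * R) (a i) S) ->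
  reaches (h * (R ^ h * (R * (t * R)))) S
    (fun S' => forall j, known (Phi V R t) (t * R)
                 (\sum_(i < R ^ h) 'X^(w * i * j) * a i) S').
Proof.
move=> t0; elim: h w a S => [|h IHh] w a S dvd ka.
  apply: reaches_now => j; rewrite expn0 big_ord1 muln0 mul0n mul1r.
  exact: ka.
have S0 : 0 \in S.
  by have [|p' [sz _ pS]] := ka 0; rewrite ?expn_gt0 //; apply: coefs_in0 pS sz.
pose b x y := a (R * y + x)%N.
pose inner x j := \sum_(i < R ^ h) 'X^(w * R * i * j) * b x i.
have monoG x : mono (fun S' => forall j, known (Phi V R t) (t * R) (inner x j) S').
  by move=> S1 S2 sS12 k1 j; apply: mono_known sS12 (k1 j).
have reach1 : reaches (R * (h * (R ^ h * (R * (t * R))))) S (fun S' =>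
    forall x, (x < R)%N -> forall j, known (Phi V R t) (t * R) (inner x j) S').
  apply: reaches_nloop => // x S' lt_x sSS'.
  apply: IHh; first by rewrite -mulnA -expnS.
  move=> i lt_i; apply: mono_known sSS' _; apply: ka.
  rewrite expnS; have := leq_mul (leqnn R) lt_i; rewrite mulnS; lia.
have split_sum j : \sum_(i < R ^ h.+1) 'X^(w * i * j) * a i =
    \sum_(x < R) 'X^(w * x * j) * inner x j.
  rewrite expnS (@big_ord_mul _ _ _ R (R ^ h) (fun i => 'X^(w * i * j) * a i)).
  apply: eq_bigr => x _.
  rewrite mulr_sumr; apply: eq_bigr => y _; rewrite mulrA -exprD.
  by congr ('X^_ * _); ring.
have reach2 S' : {subset S <= S'} ->
    (forall x, (x < R)%N -> forall j, known (Phi V R t) (t * R) (inner x j) S') ->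
    reaches (R ^ h.+1 * (R * (t * R))) S' (fun S'' => forall j,
       (j < R ^ h.+1)%N -> known (Phi V R t) (t * R)
                 (\sum_(i < R ^ h.+1) 'X^(w * i * j) * a i) S'').
  move=> sSS' kinner; apply: reaches_nloop => [j|j S'' _ sS'];
    first exact: mono_known.
  rewrite split_sum.
  apply: (@reaches_known_sum _ _ _ _ _ _ (fun x => 'X^(w * x * j) * inner x j)).
    exact/sS'/sSS'.
  by move=> x lt_x; apply/known_rot/(mono_known sS')/kinner.
have := reaches_bind reach1 reach2; apply: reaches_weaken.
  rewrite expnS; lia.
move=> S' sSS' kS' j.
have := kS' (j %% R ^ h.+1)%N; rewrite ltn_pmod ?expn_gt0 // => /(_ isT).
apply: known_cong; apply: pcong_sum => i _; apply: pcongM (pcong_refl _ _).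
apply: pcong_Phi_exp; rewrite {2}(divn_eq j (R ^ h.+1)) mulnDr.
have /dvdnP[d dE] : (t * R %| w * i * (j %/ R ^ h.+1 * R ^ h.+1))%N.
  have -> : (w * i * (j %/ R ^ h.+1 * R ^ h.+1)
    = (w * R ^ h.+1) * (i * (j %/ R ^ h.+1)))%N by ring.
  exact: dvdn_mulr.
by rewrite dE modnMDl.
Qed.

(** [Q.-1 * i] stands for [- i] modulo [Q]: exponents are natural numbers. *)
Lemma dvdn_add_pred Q d i : (i < Q)%N ->
  (Q %| d + Q.-1 * i)%N = (d %% Q == i)%N.
Proof.
move=> lt_i; have Q0 : (0 < Q)%N by apply: leq_ltn_trans lt_i.
rewrite -[X in _ == X](modn_small lt_i) -(eqn_modDr (Q.-1 * i)).
by rewrite -mulSn prednK // modnMr.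
Qed.

(** The roots [X^(w j)], for [j] prime to [R], are those of [Phi R R^h].
    Interpolating at these roots only, the values at the other powers being
    replaced by 0, involves this sum: the orthogonality relation for all
    powers, minus the one for the powers of [X^(w R)]. *)
Lemma punctured_sum h w d kap : prime R -> R%:R * kap = 1 :> V ->
  pcong (Phi V R (w * R ^ h))
    (\sum_(j < R ^ h.+1) (if (R %| j)%N then 0 else 'X^(w * d * j)))
    ((R ^ h.+1)%:R * (R ^ h.+1 %| d)%N%:R - (R ^ h)%:R * (R ^ h %| d)%N%:R).
Proof.
move=> R_pr kap1; set M := Phi _ _ _.
have -> : \sum_(j < R ^ h.+1) (if (R %| j)%N then 0 else 'X^(w * d * j)) =
    \sum_(j < R ^ h.+1) 'X^(w * d * j) - \sum_(j < R ^ h) 'X^(w * R * d * j)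
    :> {poly V}.
  apply/eqP; rewrite eq_sym subr_eq eq_sym; apply/eqP.
  have -> : \sum_(j < R ^ h) 'X^(w * R * d * j) =
     \sum_(j < R ^ h.+1) (if (R %| j)%N then 'X^(w * d * j) else 0) :> {poly V}.
    rewrite expnS (@big_ord_mul _ _ _ R (R ^ h)
      (fun j => if (R %| j)%N then 'X^(w * d * j) else 0)).
    rewrite big_ord_recl /= [X in _ + X]big1 ?addr0.
      apply: eq_bigr => j _; rewrite addn0 dvdn_mulr //.
      by congr ('X^_); ring.
    move=> i _; apply: big1 => j _.
    rewrite dvdn_addr ?dvdn_mulr // gtnNdvd //.
    by rewrite /= /bump /= add1n ltnS.
  by rewrite -big_split; apply: eq_bigr => j _ /=; case: ifP => _;
    rewrite ?addr0 ?add0r.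
have all_one n c : (w * R ^ h * R %| c)%N ->
    pcong M (\sum_(j < n) 'X^(c * j)) n%:R.
  move=> dvd; rewrite -[n in n%:R]card_ord -sumr_const; apply: pcong_sum => j _.
  rewrite -(expr0 'X); apply: pcong_Phi_exp; apply/eqP; rewrite mod0n.
  exact: dvdn_mulr.
apply: pcongD; last apply: pcongN.
  have [dvd|ndvd] := boolP (R ^ h.+1 %| d)%N.
    by rewrite mulr1; apply: all_one; rewrite -mulnA -expnSr dvdn_mul.
  by rewrite mulr0; apply: principal_root kap1 ndvd.
have [dvd|ndvd] := boolP (R ^ h %| d)%N.
  rewrite mulr1; apply: all_one.
  by rewrite -mulnA [(_ * R)%N]mulnC mulnA dvdn_mul.
rewrite mulr0; case: h @M all_one ndvd => [|h] M _ ndvd;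
  first by rewrite dvd1n in ndvd.
have -> : M = Phi V R ((w * R) * R ^ h) by rewrite /M expnS mulnA.
exact: principal_root kap1 ndvd.
Qed.

(** A polynomial with blocks of size [s] is viewed as a polynomial in
    [Z = X^s] modulo [Phi R N].  Its coefficients are multiplied modulo
    [Phi R t], where [X^w] has order [R N]; the condition [fit] makes [t]
    large enough for the products of two blocks to be recovered exactly. *)
Section Step.

Variables (h w s : nat) (kap : K).
Hypotheses (w0 : (0 < w)%N) (s0 : (0 < s)%N).
Hypotheses (R_pr : prime R) (kap1 : R%:R * kap = 1).
Local Notation N := (R ^ h)%N.
Local Notation t := (w * N)%N.
Hypothesis fit : (s + s <= t * r)%N.

Let kapV : R%:R * iota kap = 1.
Proof. by rewrite -(rmorph_nat iota) -rmorphM kap1 rmorph1. Qed.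

Let N0 : (0 < N)%N. Proof. by rewrite expn_gt0. Qed.
Let t0 : (0 < t)%N. Proof. by rewrite muln_gt0 w0. Qed.

(** The index in the last of the [R] segments of length [N] that is congruent
    to [i] modulo [N]: reducing [Z^(top i)] modulo [Phi R N] subtracts 1 from
    the coefficient of every [Z^i] with this value of [top i]. *)
Definition top i := (N * r + i %% N)%N.

(** The coefficient of [Z^i] in the reduction of [Z^d] modulo [Phi R N]. *)
Definition folding d i : V :=
  (R ^ h.+1 %| d + (R ^ h.+1).-1 * i)%N%:R
  - (R ^ h.+1 %| d + (R ^ h.+1).-1 * top i)%N%:R.

Lemma top_lt i : (top i < R ^ h.+1)%N.
Proof. by rewrite expnSr mulnS [X in (_ < X)%N]addnC ltn_add2l ltn_pmod. Qed.

Lemma foldingP d :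
  pcong (Phi V R (s * N)) (\sum_(i < N * r) 'X^(s * i) * (folding d i)%:P)
    'X^(s * d).
Proof.
pose Q := (R ^ h.+1)%N; have Q0 : (0 < Q)%N by rewrite expn_gt0.
have QE : (Q = N * r + N)%N by rewrite /Q expnSr mulnS addnC.
pose d0 := (d %% Q)%N; have lt_d0 : (d0 < Q)%N by rewrite ltn_pmod.
apply: (@pcong_trans _ _ 'X^(s * d0)); last first.
  by apply: pcong_Phi_exp; rewrite -mulnA -expnSr -!muln_modr modn_mod.
have E i : (i < N * r)%N -> (folding d i)%:P =
    (d0 == i)%:R - (d0 == top i)%:R :> {poly V}.
  move=> lt_i; rewrite /folding dvdn_add_pred ?dvdn_add_pred ?top_lt //.
    by rewrite rmorphB /= !rmorph_nat.
  by rewrite -/Q QE ltn_addr.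
have -> : \sum_(i < N * r) 'X^(s * i) * (folding d i)%:P =
    \sum_(i < N * r) ('X^(s * i) * (d0 == i)%:R - 'X^(s * i) * (d0 == top i)%:R).
  by apply: eq_bigr => i _; rewrite E // mulrBr.
rewrite sumrB.
have [lt_d|le_d] := ltnP d0 (N * r).
  rewrite (bigD1 (Ordinal lt_d)) //= eqxx mulr1 big1 => [|i]; last first.
    by rewrite -val_eqE /= eq_sym => /negPf->; rewrite mulr0.
  rewrite [X in _ - X]big1 => [|i _]; first by rewrite addr0 subr0; apply: pcong_refl.
  by rewrite ltn_eqF ?mulr0 // (leq_trans lt_d) // leq_addr.
rewrite big1 => [|i _]; last by rewrite gtn_eqF ?mulr0 // (leq_trans _ le_d).
set e := (d0 - N * r)%N; have lt_e : (e < N)%N by rewrite /e; lia.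
have d0E : d0 = (N * r + e)%N by rewrite /e; lia.
rewrite (@big_ord_mul _ _ _ N r (fun i => 'X^(s * i) * (d0 == top i)%:R)).
rewrite (bigD1 (Ordinal lt_e)) //= [X in _ - (_ + X)]big1 => [|x ne_x]; last first.
  apply: big1 => y _; rewrite d0E /top eqn_add2l [(N * y)%N]mulnC modnMDl
    modn_small //.
  by move: ne_x; rewrite -val_eqE /= eq_sym => /negPf->; rewrite mulr0.
exists (- 'X^(s * e)); rewrite Phi_recr d0E.
have -> : \sum_(i < r) 'X^(s * (N * i + e)) * (N * r + e == top (N * i + e))%N%:R
   = 'X^(s * e) * Phi V r (s * N).
  rewrite /Phi mulr_sumr; apply: eq_bigr => i _.
  rewrite /top eqn_add2l [(N * i)%N]mulnC modnMDl modn_small // eqxx mulr1 -exprD.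
  by congr ('X^_); ring.
have -> : (s * (N * r + e) = s * e + s * N * r)%N by ring.
rewrite exprD; ring.
Qed.

Section Product.

Variables a b : nat -> {poly V}.
Hypotheses (sza : forall i, (size (a i) <= s)%N).
Hypotheses (szb : forall i, (size (b i) <= s)%N).

Local Notation Q := (R ^ h.+1)%N.

Definition dft (c : nat -> {poly V}) j := \sum_(i < Q) 'X^(w * i * j) * c i.

Definition masked j := if (R %| j)%N then 0 else dft a j * dft b j.

Definition inverse i := \sum_(j < Q) 'X^(w * Q.-1 * j * i) * masked j.

(** The coefficient of [Z^i] in the product of the sums of the [a x Z^x] and
    of the [b y Z^y], reduced modulo [Phi R N] in [Z]; it is an exact
    polynomial in [X], known from its residue modulo [Phi R t] by its size. *)
Definition folded i :=
  \sum_(x < Q) \sum_(y < Q) (a x * b y) * (folding (x + y) i)%:P.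

Lemma size_folded i : (size (folded i) <= s + s)%N.
Proof.
apply: leq_trans (size_sum _ _ _) _; apply/bigmax_leqP => x _.
apply: leq_trans (size_sum _ _ _) _; apply/bigmax_leqP => y _.
rewrite mulrC mul_polyC; apply: leq_trans (size_scale_leq _ _) _.
apply: leq_trans (size_polyMleq _ _) _; apply: leq_trans (leq_pred _) _.
exact: leq_add.
Qed.

Lemma foldedP : pcong (Phi V R (s * N))
  (\sum_(i < N * r) 'X^(s * i) * folded i)
  ((\sum_(x < Q) 'X^(s * x) * a x) * (\sum_(y < Q) 'X^(s * y) * b y)).
Proof.
have -> : \sum_(i < N * r) 'X^(s * i) * folded i = \sum_(x < Q) \sum_(y < Q)
    (a x * b y) * \sum_(i < N * r) 'X^(s * i) * (folding (x + y) i)%:P.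
  under eq_bigr => i _ do rewrite /folded mulr_sumr.
  rewrite exchange_big /=; apply: eq_bigr => x _.
  under eq_bigr => i _ do rewrite mulr_sumr.
  rewrite exchange_big /=; apply: eq_bigr => y _.
  by rewrite mulr_sumr; apply: eq_bigr => i _; rewrite mulrCA.
rewrite mulr_suml; apply: pcong_sum => x _.
rewrite mulr_sumr; apply: pcong_sum => y _.
apply: pcong_trans (pcongMl _ (foldingP (x + y))) _; apply: pcong_eq.
by rewrite mulnDr exprD; ring.
Qed.

Lemma inverseE i : pcong (Phi V R t) (inverse i)
  (\sum_(x < Q) \sum_(y < Q) (a x * b y) *
     (Q%:R * (Q %| x + y + Q.-1 * i)%N%:R
      - N%:R * (N %| x + y + Q.-1 * i)%N%:R)).
Proof.
have -> : inverse i = \sum_(x < Q) \sum_(y < Q) (a x * b y) *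
    \sum_(j < Q) (if (R %| j)%N then 0 else 'X^(w * (x + y + Q.-1 * i) * j)).
  have E (j : 'I_Q) : 'X^(w * Q.-1 * j * i) * masked j =
      \sum_(x < Q) \sum_(y < Q) (a x * b y) *
      (if (R %| j)%N then 0 else 'X^(w * (x + y + Q.-1 * i) * j)).
    rewrite /masked; case: ifP => _.
      by rewrite mulr0 big1 // => x _; rewrite big1 // => y _; rewrite mulr0.
    rewrite mulr_suml mulr_sumr; apply: eq_bigr => x _.
    rewrite mulr_sumr mulr_sumr; apply: eq_bigr => y _.
    have -> : (w * (x + y + Q.-1 * i) * j
       = w * Q.-1 * j * i + (w * x * j + w * y * j))%N by ring.
    rewrite !exprD; ring.
  rewrite /inverse (eq_bigr _ (fun j _ => E j)) exchange_big /=.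
  apply: eq_bigr => x _; rewrite exchange_big /=; apply: eq_bigr => y _.
  by rewrite mulr_sumr.
apply: pcong_sum => x _; apply: pcong_sum => y _; apply: pcongMl.
exact: punctured_sum kapV.
Qed.

(** The terms of [inverseE] with factor [N] depend on [i] modulo [N] only; they
    come from the roots left out of the interpolation and disappear from the
    difference. *)
Lemma inverse_top i : pcong (Phi V R t)
  ((iota (kap ^+ h.+1))%:P * (inverse i - inverse (top i))) (folded i).
Proof.
have Qkap : (iota (kap ^+ h.+1))%:P * Q%:R = 1.
  rewrite -(rmorph_nat polyC) -rmorphM /= -(rmorph_nat iota) -rmorphM.
  by rewrite mulrC natrX -exprMn kap1 expr1n rmorph1.
apply: pcong_trans.
  by apply: pcongMl; apply: pcongD; [|apply: pcongN]; apply: inverseE.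
apply: pcong_eq; rewrite -sumrB mulr_sumr; apply: eq_bigr => x _.
rewrite -sumrB mulr_sumr; apply: eq_bigr => y _.
have -> : (N %| x + y + Q.-1 * top i)%N = (N %| x + y + Q.-1 * i)%N.
  congr (_ == 0)%N; rewrite -modnDmr -[RHS]modnDmr -modnMmr -[in RHS]modnMmr.
  by rewrite /top [(N * r)%N]mulnC modnMDl modn_mod.
rewrite /folding rmorphB /= !rmorph_nat;
  move: (_ %| _)%N (_ %| _)%N (_ %| _)%N => b1 b2 b3.
rewrite -[RHS]mul1r -[X in _ = X * _]Qkap;
  move: (_%:P) (Q%:R : {poly V}) (N%:R : {poly V}) (a x * b y) => k q n ab.

ring.
Qed.

End Product.

Definition mulmod_cost m c := forall S p q,
  known (Phi V R m) (m * r) p S -> known (Phi V R m) (m * r) q S ->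
  reaches c S (known (Phi V R m) (m * r) (p * q)).

Definition fft_cost := (h.+1 * (R ^ h.+1 * (R * (t * R))))%N.

(** Two transforms, the products at the roots prime to [R] (after reduction of
    the operands), the inverse transform, the recovery of the coefficients,
    and the addition of overlapping blocks. *)
Definition step_cost c :=
  (fft_cost + (fft_cost
   + (\sum_(j < R ^ h.+1) (if R %| j then 0 else t * R + (t * R + c))
   + (fft_cost + (N * r * (t * R + (t * R + t * R))
   + (s * N * R + s * N * R))))))%N.

Lemma mulmod_step c : mulmod_cost t c -> mulmod_cost (s * N) (step_cost c).
Proof.
move=> mul_t S p q [p' [szp cp pS]] [q' [szq cq qS]].
have S0 := coefs_in0 pS szp.
have reaches_pq : reaches (step_cost c) S (known (Phi V R (s * N)) (s * N * r)
  (p' * q')).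
  pose a := block s p'; pose b := block s q'.
  have sza i : (size (a i) <= s)%N by apply: size_block.
  have szb i : (size (b i) <= s)%N by apply: size_block.
  have le_s : (s <= t * R)%N.
    by rewrite (leq_trans (leq_addr s s)) // (leq_trans fit) // leq_mul2l leqnSn orbT.
  have szQ n : (n <= s * N * r -> n <= s * R ^ h.+1)%N.
    by move/leq_trans; apply; rewrite -mulnA leq_mul2l expnSr leq_mul2l leqnSn !orbT.
  have pE : p' = \sum_(x < R ^ h.+1) 'X^(s * x) * a x by apply: blockE => //;
    apply: szQ.
  have qE : q' = \sum_(x < R ^ h.+1) 'X^(s * x) * b x by apply: blockE => //;
    apply: szQ.
  have dvd_t : (t * R %| w * R ^ h.+1)%N by rewrite -mulnA -expnSr.
  apply: reaches_bind; first apply: (reaches_dft (a := a) t0 dvd_t).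
    by move=> i _; apply: known_coefs;
      [apply: leq_trans le_s | apply: coefs_in_block].
  move=> S1 sSS1 ka; apply: reaches_bind.
    apply: (reaches_dft (a := b) t0 dvd_t) => i _; apply: known_coefs.
      exact: leq_trans le_s.
    by apply: coefs_in_block; [apply: sSS1 | apply: mono_coefs_in qS].
  move=> S2 sS12 kb.
  have {}ka j := mono_known sS12 (ka j).
  have S20 : 0 \in S2 by apply/sS12/sSS1.
  apply: reaches_bind.
    apply: (reaches_loop (c := fun j => (if R %| j then 0 else t * R + (t * R + c))%N)
      (G := fun j => known (Phi V R t) (t * R) (masked a b j))).
      by move=> j; apply: mono_known.
    move=> j S' _ sS2S'; rewrite /masked; case: ifP => _.
      by apply/reaches_now/known0/sS2S'.
    apply: reaches_bind.
      by apply: (reaches_reduce t0); apply: mono_known sS2S' (ka j).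
    move=> S'' sS'' ka'; apply: reaches_bind.
      by apply: (reaches_reduce t0); apply: mono_known (kb j) => x /sS2S'/sS''.
    move=> S3 sS3 kb'; have {}ka' := mono_known sS3 ka'.
    apply: reaches_weaken (leqnn _) _ (mul_t _ _ _ ka' kb') => S4 _ [u [szu cu uS]].
    by exists u; split=> //; rewrite (leq_trans szu) // leq_mul2l leqnSn orbT.
  move=> S3 sS23 kmask.
  apply: reaches_bind.
    apply: (reaches_dft (w := (w * (R ^ h.+1).-1)%N) t0 _ kmask).
    by rewrite [X in (_ %| X)%N]mulnAC dvdn_mulr.
  move=> S4 sS34 kinv.
  have kinverse i : known (Phi V R t) (t * R) (inverse a b i) S4 := kinv i.
  have S40 : 0 \in S4 by apply/sS34/sS23.
  apply: reaches_bind.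
    apply: (reaches_nloop (G := fun i => coefs_in (folded a b i))).
      by move=> i; apply: mono_coefs_in.
    move=> i S' _ sS4S'; apply: reaches_bind.
      by apply: reaches_known_sub; apply: mono_known sS4S' _;
        [apply: (kinverse i) | apply: (kinverse (top i))].
    move=> S5 _ ksub; apply: reaches_bind.
      exact: (reaches_known_scale iota (kap ^+ h.+1) ksub).
    move=> S6 _ kscale; have := reaches_reduce t0 kscale.
    apply: reaches_weaken => // S7 _ [u [szu cu uS]].
    (* [folded] is small enough to equal its representative modulo [Phi R t]. *)
    suff <- : u = folded a b i by [].
    apply: (pcong_Phi_uniq t0 szu); first by apply: leq_trans fit; apply: size_folded.
    exact: pcong_trans cu (inverse_top a b i).
  move=> S5 sS45 fS5.
  have S50 : 0 \in S5 by apply: sS45.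
  (* A product of two blocks spans two blocks; the low and the high halves,
     taken separately, can be concatenated without overlap. *)
  pose lo i := block s (folded a b i) 0; pose hi i := block s (folded a b i) 1.
  have szlo i : (size (lo i) <= s)%N by apply: size_block.
  have szhi i : (size (hi i) <= s)%N by apply: size_block.
  have foldE i : folded a b i = lo i + 'X^s * hi i.
    rewrite [LHS](@blockE _ s 2) ?size_folded //.
      by rewrite !big_ord_recl big_ord0 addr0 /= /bump /= muln0 mul1r muln1.
    by rewrite muln2 -addnn size_folded.
  have le_sz : (s * (N * r) <= s * N * R)%N by rewrite mulnA leq_mul2l leqnSn orbT.
  have klo : known (Phi V R (s * N)) (s * N * R) (\sum_(i < N * r) 'X^(s * i) *
    lo i) S5.
    apply: known_coefs; first by apply: leq_trans le_sz; apply: size_blocks.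
    by apply: coefs_in_blocks => // i lt_i; apply: coefs_in_block => //; apply: fS5.
  have khi : known (Phi V R (s * N)) (s * N * R) (\sum_(i < N * r) 'X^(s * i) *
    hi i) S5.
    apply: known_coefs; first by apply: leq_trans le_sz; apply: size_blocks.
    by apply: coefs_in_blocks => // i lt_i; apply: coefs_in_block => //; apply: fS5.
  have sN0 : (0 < s * N)%N by rewrite muln_gt0 s0.
  apply: reaches_bind; first exact: reaches_known_add klo (known_rot s sN0 khi).
  move=> S6 _ kz; have := reaches_reduce sN0 kz; apply: reaches_weaken => // S7 _.
  apply: known_cong; rewrite pE qE; apply: pcong_trans (foldedP a b).
  apply: pcong_eq; rewrite mulr_sumr -big_split; apply: eq_bigr => i _ /=.
  by rewrite foldE; ring.
apply: reaches_weaken reaches_pq => // S' _; apply: known_cong.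
exact: pcongM.
Qed.

End Step.
End Transform.

(** * The recursion *)

(** The relation [r * R ^ eps = 2], with [R = r + 1], has the solutions
    [R = 2], [eps = 1] and [R = 3], [eps = 0].  It expresses that a product of
    two blocks of size [s] just fits modulo [Phi R (s R^eps)], so that one step
    doubles the total size of the data; any larger factor would spoil the
    final bound. *)
Section Recursion.

Variables (K : fieldType) (V : comNzRingType) (iota : {rmorphism K -> V}).
Variables (r eps : nat) (kap : K).
Local Notation R := r.+1.
Hypotheses (R_pr : prime R) (kap1 : R%:R * kap = 1).
Hypothesis r_eps : (r * R ^ eps = 2)%N.

(** The base case of the recursion: schoolbook multiplication. *)
Lemma mulmod_naive t : (0 < t)%N ->
  mulmod_cost iota r t (8 * (t * r) ^ 2 + (t * R + t * R)).
Proof.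
move=> t0 S p q [p' [szp cp pS]] [q' [szq cq qS]].
have S0 := coefs_in0 pS szp.
have le_szpq : (size (p' * q')%R <= t * R * 2)%N.
  apply: leq_trans (size_polyMleq _ _) _; apply: leq_trans (leq_pred _) _.
  by apply: leq_trans (leq_add szp szq) _; rewrite mulnS; lia.
have := reaches_naive_mul iota S0 szp szq pS qS.
have -> : ((t * r + t * r) * ((t * r + t * r) * 2) = 8 * (t * r) ^ 2)%N by ring.
move=> reach_pq; apply: (reaches_bind reach_pq) => S1 sSS1 pqS1.
have S10 : 0 \in S1 := sSS1 _ S0.
have tR0 : (0 < t * R)%N by rewrite muln_gt0 t0.
have kblock i : known (Phi V R t) (t * R) (block (t * R) (p' * q') i) S1.
  by apply: known_coefs; [apply: size_block | apply: coefs_in_block].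
apply: reaches_bind.
  exact: reaches_known_add (kblock 0) (known_rot (t * R) t0 (kblock 1)).
move=> S2 _ kpq; have := reaches_reduce iota t0 kpq; apply: reaches_weaken => // S3 _.
apply: known_cong; apply: (@pcong_trans _ _ (p' * q')); last exact: pcongM.
apply: pcong_eq; rewrite [RHS](@blockE _ (t * R) 2) //.
by rewrite !big_ord_recl big_ord0 addr0 /= /bump /= muln0 mul1r muln1.
Qed.

Lemma step_cost_le h w s c : (s + s <= w * R ^ h * r)%N ->
  (step_cost r h w s c <=
   r * R ^ h * c + 10 * R ^ 3 * (h.+1 * (R ^ h * (w * R ^ h))))%N.
Proof.
move=> fit; rewrite /step_cost /fft_cost.
rewrite [in \sum_(_ < _) _]expnS.
rewrite (big_ord_mul addn R (R ^ h)
  (fun j => if R %| j then 0 else w * R ^ h * R + (w * R ^ h * R + c))%N).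
rewrite big_ord_recl /= big1 => [|y _]; last first.
  by rewrite addn0 dvdn_mulr.
rewrite add0n (eq_bigr (fun=> R ^ h * (w * R ^ h * R + (w * R ^ h * R + c)))%N).
  rewrite sum_nat_const card_ord.
  set N := (R ^ h)%N in fit *; set t := (w * N)%N in fit *.
  have : (s * N * R + s * N * R <= t * r * N * R)%N.
    by rewrite -!mulnDl !leq_mul2r fit !orbT.
  move=> le_sN; set Y := (R ^ 3 * (h.+1 * (N * t)))%N.
  have fftE : (h.+1 * (R * N * (R * (t * R))) = Y)%N by rewrite /Y; ring.
  have le_Y : (R * R * (N * t) <= Y)%N.
    have -> : (Y = (R * R * (N * t)) * (R * h.+1))%N by rewrite /Y; ring.
    by rewrite leq_pmulr.
  have le_rR : (r * R * (N * t) <= R * R * (N * t))%N by rewrite !leq_mul2r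
    leqnSn !orbT.
  have E1 : (t * r * N * R = r * R * (N * t))%N by ring.
  have E2 : (N * r * (t * R + (t * R + t * R)) = 3 * (r * R * (N * t)))%N by ring.
  have E3 : (r * (N * (t * R + (t * R + c))) = r * N * c + 2 * (r * R * (N * t)))%N.
    by ring.
  rewrite [(R ^ h.+1)%N]expnS fftE E2 E3 -[(10 * _ * _)%N]mulnA -/Y.
  move: le_sN; rewrite E1.
  move: (r * R * _)%N (R * R * _)%N (s * N * R)%N (r * N * c)%N le_Y le_rR
    => a1 a2 a3 a4.
  clearbody Y; clear; lia.
move=> x _; rewrite (eq_bigr (fun=> (w * R ^ h * R + (w * R ^ h * R + c))%N)).
  by rewrite sum_nat_const card_ord.
move=> y _; rewrite dvdn_addr ?dvdn_mulr // gtnNdvd //.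
by rewrite /= /bump /= add1n ltnS.
Qed.

(** Up to a constant factor, the cost of a multiplication modulo [Phi R (R^k)]
    relative to [R^k].  The shift by 4 makes up for the rounding in the
    recursion, which goes from [k] to at most [k / 2 + 3 / 2]. *)
Definition load k := let x := maxn 1 (k - 4) in (x * (trunc_log 2 x).+1)%N.

Lemma load_gt0 k : (0 < load k)%N.
Proof. by rewrite /load muln_gt0 /= leq_max. Qed.

Lemma eps_le1 : (eps <= 1)%N.
Proof.
have R1 := prime_gt1 R_pr; rewrite leqNgt; apply/negP => eps2.
have le4 : (2 ^ 2 <= R ^ eps)%N.
  by apply: leq_trans (leq_pexp2l (ltn0Sn r) eps2); rewrite leq_exp2r.
have : (R ^ eps <= 2)%N by rewrite -[X in (_ <= X)%N]r_eps leq_pmull.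
by rewrite leqNgt (leq_trans _ le4).
Qed.

(** One step at least halves [maxn 1 (k - 4)] and lowers its logarithm by 1;
    twice the new load is thus smaller than the old one by [maxn 1 (k - 4)],
    which is at least [k / 3]. *)
Lemma load_half k : (5 < k)%N ->
  (3 * (2 * load (k - k./2 + eps)) + k <= 3 * load k)%N.
Proof.
move=> k5; have le_eps := eps_le1.
rewrite /load; set x := maxn 1 (k - 4).
have xE : (x = k - 4)%N by rewrite /x; lia.
set y := maxn 1 _; have le_yx : (y <= x./2)%N by rewrite /y; lia.
have x2 : (1 < x)%N by lia.
have -> : trunc_log 2 x = (trunc_log 2 x./2).+1 by rewrite trunc_log2S.
have le_log : (trunc_log 2 y <= trunc_log 2 x./2)%N by apply: leq_trunc_log.
set a := trunc_log 2 y in le_log *; set b := trunc_log _ _ in le_log *.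
have le_ya : (2 * (y * a.+1) <= x * b.+1)%N.
  rewrite mulnA leq_mul //.
  by apply: leq_trans (leq_mul (leqnn 2) le_yx) _; lia.
have -> : (x * b.+2 = x * b.+1 + x)%N by ring.
by move: (_ * _)%N (x * b.+1)%N le_ya => u v le_uv; lia.
Qed.

Lemma mulmod_fast k :
  mulmod_cost iota r (R ^ k) (100 * R ^ 7 * R ^ k * load k).
Proof.
elim/ltn_ind: k => k IHk.
have R1 := prime_gt1 R_pr.
have weaken m c d : (c <= d)%N -> mulmod_cost iota r m c -> mulmod_cost iota r m d.
  by move=> le_cd mulc S p q kp kq; apply: reaches_weaken le_cd _ (mulc S p q kp kq).
have [k5|k5] := leqP k 5.
  apply: weaken (mulmod_naive _); last by rewrite expn_gt0.
  have le5 : (R ^ k <= R ^ 5)%N by rewrite leq_exp2l.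
  have le1 : ((R ^ k * r) ^ 2 <= R ^ 7 * R ^ k)%N.
    have -> : ((R ^ k * r) ^ 2 = (R ^ k * (r * r)) * R ^ k)%N by ring.
    by rewrite leq_mul2r (expnD R 5 2) orbC leq_mul // -mulnn leq_mul.
  have le2 : (R ^ k * R <= R ^ 7 * R ^ k)%N.
    by rewrite mulnC leq_mul // -[X in (X <= _)%N]expn1 leq_exp2l.
  apply: leq_trans (leq_pmulr _ (load_gt0 k)); rewrite -[(100 * _ * _)%N]mulnA.
  move: le1 le2; move: ((_ * r) ^ 2)%N (R ^ k * R)%N (R ^ 7 * R ^ k)%N => a b c.
  by clear; lia.
(* The blocks have size [R^(k-h)], and their products live modulo
   [Phi R (R^e)]. *)
set h := k./2; set e := (k - h + eps)%N.
have le_eps := eps_le1.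
have he : (h <= e)%N by rewrite /e /h; lia.
have lt_e : (e < k)%N by rewrite /e /h; lia.
have cost_e := IHk e lt_e.
have RkE : (R ^ k = R ^ (k - h) * R ^ h)%N by rewrite -expnD subnK // /h; lia.
have ReE : (R ^ e = R ^ (e - h) * R ^ h)%N by rewrite -expnD subnK.
have fitE : (R ^ e * r = R ^ (k - h) + R ^ (k - h))%N.
  by rewrite /e expnD -mulnA [(R ^ eps * r)%N]mulnC r_eps muln2 addnn.
rewrite RkE; rewrite ReE in cost_e.
apply: weaken (mulmod_step _ _ R_pr kap1 _ cost_e); rewrite ?expn_gt0 //; last first.
  by rewrite -ReE fitE.
apply: leq_trans (step_cost_le _ _) _; first by rewrite -ReE fitE.
rewrite -ReE -RkE.
have E1 : (R ^ h * R ^ e = R ^ k * R ^ eps)%N.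
  by rewrite -!expnD /e /h; congr (_ ^ _)%N; lia.
have -> : (r * R ^ h * (100 * R ^ 7 * R ^ e * load e) =
   100 * R ^ 7 * (r * (R ^ h * R ^ e)) * load e)%N by ring.
rewrite E1 [(r * _)%N]mulnCA r_eps.
have R2 : (R ^ eps <= 2)%N.
  by rewrite -[X in (_ <= X)%N]r_eps leq_pmull.
have := load_half k5; rewrite -/h -/e => half.
have le_h : (h.+1 <= k)%N by rewrite /h; lia.
have le_R : (20 * R ^ 3 <= 33 * R ^ 7)%N.
  by apply: leq_mul => //; rewrite leq_exp2l.
have le2 : (10 * R ^ 3 * (h.+1 * (R ^ k * R ^ eps)) <= 33 * R ^ 7 * (k * R ^ k))%N.
  apply: (@leq_trans (20 * R ^ 3 * (h.+1 * R ^ k))); last first.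
    by rewrite leq_mul // leq_mul2r le_h orbT.
  have -> : (20 * R ^ 3 * (h.+1 * R ^ k) = 10 * R ^ 3 * (h.+1 * (R ^ k * 2)))%N
    by ring.
  by rewrite !leq_mul2l R2 !orbT.
have := leq_mul (leqnn (33 * R ^ 7 * R ^ k)%N) half.
move: le2; set u := (R ^ 7)%N; set v := (R ^ k)%N => le2.
rewrite mulnDr.
have -> : (33 * u * v * (3 * (2 * load e)) = 99 * (u * (v * 2) * load e))%N by ring.
have -> : (33 * u * v * (3 * load k) = 99 * (u * v * load k))%N by ring.
have -> : (33 * u * v * k = 33 * u * (k * v))%N by ring.
have -> : (100 * u * (v * 2) * load e = 100 * (u * (v * 2) * load e))%N by ring.
have -> : (100 * u * v * load k = 100 * (u * v * load k))%N by ring.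
have half2 : (u * (v * 2) * load e <= u * v * load k)%N.
  rewrite -!mulnA !leq_mul2l; apply/orP; right; apply/orP; right.
  by move: half; move: (load e) (load k) => a b; clear; lia.
move: le2 half2; move: (u * (v * 2) * _)%N (u * v * _)%N (33 * u * _)%N (10 * _ *
  _)%N.
clear; lia.
Qed.

End Recursion.

(** * Cyclic convolutions *)

Section Convolution.

Variables (K : fieldType) (V : comNzRingType) (iota : {rmorphism K -> V}).
Implicit Types (S : seq V).
Local Notation reaches := (reaches iota).

Definition conv n (c b : nat -> V) k := \sum_(j < n) c ((k + n - j) %% n)%N * b j.

Lemma coef_mul_poly n (c b : nat -> V) k :
  ((\poly_(i < n) c i) * (\poly_(i < n) b i))`_k =
  \sum_(j < n) (if (k < j)%N then 0 else (\poly_(i < n) c i)`_(k - j)) * b j.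
Proof.
rewrite mulrC [\poly_(i < n) b i]poly_def mulr_suml coef_sum.
by apply: eq_bigr => j _; rewrite -scalerAl coefZ coefXnM mulrC.
Qed.

(** A cyclic convolution folds a product of polynomials of size at most [n]. *)
Lemma convE n (c b : nat -> V) k : (k < n)%N ->
  conv n c b k = ((\poly_(i < n) c i) * (\poly_(i < n) b i))`_k
               + ((\poly_(i < n) c i) * (\poly_(i < n) b i))`_(k + n).
Proof.
move=> lt_k; rewrite !coef_mul_poly -big_split; apply: eq_bigr => j _ /=.
rewrite -mulrDl; congr (_ * _); have lt_j := ltn_ord j.
have E1 : (k + n < j)%N = false by lia.
rewrite !coef_poly E1; have [lt_kj|le_jk] := ltnP k j.
  have E2 : (k + n - j < n)%N by lia.
  by rewrite E2 modn_small // add0r.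
have [E2 E3] : (k - j < n)%N /\ (k + n - j < n)%N = false by lia.
by rewrite E2 E3 addr0 -addnBAC // modnDr modn_small.
Qed.

Lemma exists_radix : exists r eps, exists kap : K,
  [/\ prime r.+1, r.+1%:R * kap = 1, (r * r.+1 ^ eps = 2)%N & (r <= 2)%N].
Proof.
have [two0|two0] := eqVneq (2%:R : K) 0.
  exists 2, 0, 1; split=> //; rewrite mulr1 -[3%N]/(1 + 2)%N natrD two0 addr0.
  by [].
by exists 1%N, 1%N, (2%:R^-1); split=> //; rewrite divff.
Qed.

Definition mul_load n := (100 * 3 ^ 7 * (3 * (n + n)) * load (up_log 2 (n + n)))%N.

Lemma leq_load k1 k2 : (k1 <= k2)%N -> (load k1 <= load k2)%N.
Proof.
move=> le_k; rewrite /load.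
have le_x : (maxn 1 (k1 - 4) <= maxn 1 (k2 - 4))%N by lia.
by apply: leq_mul => //; rewrite ltnS leq_trunc_log.
Qed.

Lemma reaches_poly_mul n (p q : {poly V}) S : (0 < n)%N ->
  (size p <= n)%N -> (size q <= n)%N -> coefs_in p S -> coefs_in q S ->
  reaches (mul_load n) S (coefs_in (p * q)).
Proof.
move=> n0 szp szq pS qS; have [r [eps [kap [R_pr kap1 r_eps le_r]]]] := exists_radix.
have R1 := prime_gt1 R_pr; have r0 : (0 < r)%N by [].
set k := up_log r.+1 (n + n).
have le_nk : (n + n <= r.+1 ^ k)%N by apply: up_logP.
have le_kn : (r.+1 ^ k <= 3 * (n + n))%N.
  have n2 : (1 < n + n)%N by lia.
  have k0 : (0 < k)%N by rewrite up_log_gt0 R1.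
  have /andP[lt_k _] := up_log_bounds R1 n2.
  by rewrite -(prednK k0) expnS leq_mul // ltnW.
have kp (u : {poly V}) : (size u <= n)%N -> coefs_in u S ->
    known (Phi V r.+1 (r.+1 ^ k)) (r.+1 ^ k * r) u S.
  move=> szu uS; apply: known_coefs => //; apply: leq_trans szu _.
  by apply: leq_trans (leq_pmulr _ r0); apply: leq_trans le_nk; apply: leq_addr.
have := mulmod_fast iota R_pr kap1 r_eps (kp p szp pS) (kp q szq qS).
apply: reaches_weaken.
  rewrite /mul_load; apply: leq_mul; first apply: leq_mul => //.
    by rewrite leq_mul2l /= leq_exp2r.
  apply: leq_load; apply: up_log_min => //;
    apply: leq_trans (up_logP (n + n) (isT : (1 < 2)%N)) _.
  by rewrite leq_exp2r // up_log_gt0; lia.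
move=> S' _ [u [szu cu uS]].
suff <- : u = p * q by [].
apply: pcong_Phi_uniq szu _ cu; first by rewrite expn_gt0.
apply: leq_trans (size_polyMleq _ _) _; apply: leq_trans (leq_pred _) _.
by apply: leq_trans (leq_add szp szq) (leq_trans le_nk (leq_pmulr _ r0)).
Qed.

Definition conv_cost n := (n + (mul_load n + n))%N.

Lemma reaches_conv n (c : nat -> K) (b : nat -> V) S : (0 < n)%N -> 0 \in S ->
  (forall j, (j < n)%N -> b j \in S) ->
  reaches (conv_cost n) S (fun S' => forall k, (k < n)%N ->
    conv n (fun i => iota (c i)) b k \in S').
Proof.
move=> n0 S0 bS.
have poly_in (a : nat -> V) S' : 0 \in S' -> (forall j, (j < n)%N -> a j \in S') ->
    coefs_in (\poly_(i < n) a i) S'.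
  by move=> S'0 aS' i; rewrite coef_poly; case: ifP => [/aS'|].
apply: reaches_bind.
  rewrite -[n in reaches n]muln1.
  apply: (reaches_nloop (G := fun i S' => iota (c i) \in S')).
    by move=> i; apply: mono_mem.
  by move=> i S' _ sS; apply: reaches_const; apply: sS.
move=> S1 sS1 cS1; apply: reaches_bind.
  apply: (reaches_poly_mul n0 (size_poly _ _) (size_poly _ _)).
    by apply: (poly_in (fun i => iota (c i))) => //; apply: sS1.
  by apply: (poly_in b) => [|j lt_j]; apply: sS1 => //; apply: bS.
move=> S2 _ pS2; rewrite -[n in reaches n]muln1.
apply: (reaches_nloop (G := fun k S' => conv n (fun i => iota (c i)) b k \in S')).
  by move=> i; apply: mono_mem.
move=> k S3 lt_k sS3; rewrite convE //; apply: reaches_add; exact: sS3.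
Qed.

(** The [k]-th coordinate of a product in a basis multiplied by the addition
    formula of the cotangent: [g] and [h] come from the two terms of that
    formula, [s] from the squares, and [d] from its constant. *)
Definition cot_coord n (g h s : nat -> K) (d : K) (a b : nat -> V) k : V :=
  a k * conv n (fun i => iota (g i)) b k
  + b k * conv n (fun i => iota (h i)) a k
  + conv n (fun i => iota (s i)) (fun i => a i * b i) k
  + ((\sum_(i < n) a i) * (\sum_(i < n) b i) - \sum_(i < n) a i * b i) * iota d.

Definition cot_cost n := (3 * conv_cost n + (9 * n + 4))%N.

Lemma reaches_cot_coord n g h s d (a b : nat -> V) S : (0 < n)%N ->
  (forall j, (j < n)%N -> a j \in S) -> (forall j, (j < n)%N -> b j \in S) ->
  reaches (cot_cost n) S (fun S' => forall k, (k < n)%N ->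
    cot_coord n g h s d a b k \in S').
Proof.
move=> n0 aS bS; pose C := conv_cost n.
have -> : (cot_cost n =
    1 + (C + (C + (n * 1 + (C + (n + (n + (n + (1 + (1 + (1 + n * 5)))))))))))%N.
  by rewrite /cot_cost /C; ring.
have sum_in (f : nat -> V) T : 0 \in T -> (forall j, (j < n)%N -> f j \in T) ->
    reaches n T (fun T' => \sum_(i < n) f i \in T').
  move=> T0 fT; rewrite -[n in reaches n]muln1.
  apply: reaches_sum => // i T' lt_i sT; apply: reaches_now; apply/sT/fT => //.
apply: reaches_bind.
  by have := reaches_scale iota 0 (aS 0%N n0); rewrite rmorph0 mulr0; apply.
move=> S1 sS1 S10; have aS1 j lt_j := sS1 _ (aS j lt_j);
  have bS1 j lt_j := sS1 _ (bS j lt_j).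
apply: reaches_bind; first exact: (reaches_conv g n0 S10 bS1).
move=> S2 sS2 gb; have aS2 j lt_j := sS2 _ (aS1 j lt_j);
  have bS2 j lt_j := sS2 _ (bS1 j lt_j).
apply: reaches_bind; first exact: (reaches_conv h n0 (sS2 _ S10) aS2).
move=> S3 sS3 ha; apply: reaches_bind.
  apply: (reaches_nloop (G := fun i S' => a i * b i \in S')) => [i|i S' lt_i sS].
    exact: mono_mem.
  by apply: reaches_mul; apply/sS/sS3; [apply: aS2 | apply: bS2].
move=> S4 sS4 ab; have S40 : 0 \in S4 by apply/sS4/sS3/sS2.
apply: reaches_bind; first exact: (reaches_conv (b := fun i
  => a i * b i) s n0 S40 ab).
move=> S5 sS5 sab; have S50 := sS5 _ S40.
have aS5 j lt_j : a j \in S5 := sS5 _ (sS4 _ (sS3 _ (aS2 j lt_j))).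
have bS5 j lt_j : b j \in S5 := sS5 _ (sS4 _ (sS3 _ (bS2 j lt_j))).
apply: reaches_bind; first exact: (sum_in a S5).
move=> S6 sS6 suma; apply: reaches_bind.
  by apply: (sum_in b S6) => [|j lt_j]; apply: sS6 => //; apply: bS5.
move=> S7 sS7 sumb; apply: reaches_bind.
  apply: (sum_in (fun i => a i * b i) S7) => [|j lt_j].
    exact/sS7/sS6.
  exact/sS7/sS6/sS5/ab.
move=> S8 sS8 sumab; apply: reaches_bind.
  exact: (reaches_mul iota (sS8 _ (sS7 _ suma)) (sS8 _ sumb)).
move=> S9 sS9 prod; apply: reaches_bind.
  exact: (reaches_sub iota prod (sS9 _ sumab)).
move=> S10' sS10 diff; apply: reaches_bind; first exact: (reaches_scale iota d diff).
move=> S11 sS11 last; have sS x : x \in S5 -> x \in S11.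
  by move=> xS; apply/sS11/sS10/sS9/sS8/sS7/sS6.
apply: (reaches_nloop (G := fun k S' => cot_coord n g h s d a b k \in S'))
  => [i|k S' lt_k sS'].
  exact: mono_mem.
rewrite -[5%N]/(1 + (1 + (1 + (1 + 1))))%N; apply: reaches_bind.
  apply: (reaches_mul iota (a := a k) (b := conv n (fun i => iota (g i)) b k)).
    by apply/sS'/sS/aS5.
  by apply/sS'/sS/sS5/sS4/sS3/gb.
move=> T1 sT1 x1; apply: reaches_bind.
  apply: (reaches_mul iota (a := b k) (b := conv n (fun i => iota (h i)) a k)).
    by apply/sT1/sS'/sS/bS5.
  by apply/sT1/sS'/sS/sS5/sS4/ha.
move=> T2 sT2 x2; apply: reaches_bind; first exact: (reaches_add iota (sT2 _ x1) x2).
move=> T3 sT3 x3; apply: reaches_bind.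
  apply: (reaches_add iota x3 (b := conv n (fun i => iota (s i)) (fun i
    => a i * b i) k)).
  by apply/sT3/sT2/sT1/sS'/sS/sab.
move=> T4 sT4 x4; apply: (reaches_add iota x4).
by apply/sT4/sT3/sT2/sT1/sS'.
Qed.

End Convolution.

(** * Homographies of order n *)

Section FiniteFieldFacts.

Variable K : finFieldType.
Local Notation q := #|K|.

Lemma pnat_card_finField : [pchar K].-nat q.
Proof.
have [p p_pr pcharKp] := finPcharP K.
rewrite (eq_pnat _ (pcharf_eq pcharKp)).
by have := pprimeChar_pgroup pcharKp; rewrite /pgroup cardsT.
Qed.

Lemma natr_card_finField : q%:R = 0 :> K.
Proof.
have [p p_pr pcharKp] := finPcharP K; apply/eqP; rewrite -(dvdn_pcharf pcharKp).
have := pnat_card_finField; rewrite (eq_pnat _ (pcharf_eq pcharKp)).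
case/p_natP=> -[|k] qE; last by rewrite qE expnS dvdn_mulr.
by have := finNzRing_gt1 K; rewrite qE.
Qed.

End FiniteFieldFacts.

(** The second component is the Lucas sequence of parameters [tau] and [nu]; the
    pair gives the coordinates of [g^m] on [1] and [g] when [g] is a root of
    [X^2 - tau X + nu]. *)
Definition lucas (K : comNzRingType) (tau nu : K) (m : nat) : K * K :=
  iter m (fun z => (- nu * z.2, z.1 + tau * z.2)) (1, 0).

Lemma lucasP (K : fieldType) (L : fieldExtType K) (tau nu : K) (g : L) m :
  g ^+ 2 = tau *: g - nu%:A ->
  g ^+ m = (lucas tau nu m).1%:A + (lucas tau nu m).2 *: g.
Proof.
move=> g2; elim: m => [|m IHm]; first by rewrite /= scale0r addr0 scale1r.
rewrite exprSr IHm /=; move: (lucas _ _ _).1 (lucas _ _ _).2 => x y.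
rewrite mulrDl -!scalerAl mul1r -expr2 g2 scalerDl scalerBr !scalerA.
by rewrite mulNr scaleNr [nu * y]mulrC [tau * y]mulrC addrA addrC.
Qed.

Section LucasExistence.

Variable K : finFieldType.
Local Notation q := #|K|.

Lemma frobenius_lalg (A : comNzRingType) (x y : A) :
  [pchar A] =i [pchar K] -> (x + y) ^+ q = x ^+ q + y ^+ q.
Proof.
by move=> eqA; apply: exprDn_pchar; rewrite (eq_pnat _ eqA) pnat_card_finField.
Qed.

Lemma in_base_field (L : fieldExtType K) (x : L) :
  x ^+ q = x -> exists c : K, x = c%:A.
Proof.
move=> xq; apply/vlineP; rewrite (Fermat's_little_theorem 1%AS).
by rewrite dimv1 expn1 xq.
Qed.

Lemma base_field_expq (L : fieldExtType K) (c : K) : (c%:A : L) ^+ q = c%:A.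
Proof. by rewrite exprZn expr1n expf_card. Qed.

Lemma exists_quadratic_prim_root :
  exists (L : fieldExtType K) (rho : L), (q ^ 2).-1.-primitive_root rho.
Proof.
set N := (q ^ 2).-1.
have q1 : (1 < q)%N := finNzRing_gt1 K.
have N0 : (0 < N)%N by rewrite /N -ltnS prednK ?expn_gt0 ?(ltnW q1) //
  (@ltn_exp2l q 0 2).
have [L [rs rsE _]] := FinSplittingFieldFor (monic_neq0 (monicXnsubC (1 : K) N0)).
exists L; have polyE : map_poly (in_alg L) ('X^N - 1%:P) = 'X^N - 1.
  by rewrite rmorphB /= map_polyXn map_polyC /= scale1r.
rewrite polyE in rsE.
have sep : uniq rs.
  rewrite -separable_prod_XsubC -(eqp_separable rsE); apply: separable_Xn_sub_1.
  have -> : N%:R = (-1 : K)%:A :> L.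
    rewrite -(rmorph_nat (in_alg L)); congr (_ *: _); apply/eqP.
    rewrite -subr_eq0 opprK natr1 prednK ?expn_gt0 ?(ltnW q1) //.
    by rewrite natrX natr_card_finField expr0n.
  by rewrite scaler_eq0 oppr_eq0 !oner_eq0.
have rootsN : all N.-unity_root rs.
  apply/allP => z z_rs; rewrite /root_of_unity (eqp_root rsE).
  by rewrite root_prod_XsubC.
have szN : size rs = N.
  have /eqP := eqp_size rsE; rewrite size_prod_XsubC size_XnsubC // eqSS.
  by move/eqP.
have /hasP[rho _ rhoP] := has_prim_root N0 rootsN sep (eq_leq (esym szN)).
by exists rho.
Qed.

(** Take [g] of degree 2 over [K] such that [g^(q-1)] has order [n]: a power of
    [g] lies in [K] when its [(q-1)]-th power is 1, that is when [n] divides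
    the exponent.  The parameters are the trace and the norm of [g]. *)
Lemma exists_lucas n : (1 < n)%N -> (n %| q.+1)%N ->
  exists tau nu : K,
    (forall x, x ^+ 2 - tau * x + nu != 0) /\
    (forall m, ((lucas tau nu m).2 == 0) = (n %| m)%N).
Proof.
move=> n1 n_dvd; have q1 : (1 < q)%N := finNzRing_gt1 K.
have [L [rho rhoP]] := exists_quadratic_prim_root.
have [d dE] := dvdnP n_dvd; pose g := rho ^+ d.
have NE : ((q ^ 2).-1 = n * (d * q.-1))%N by nia.
have zP : n.-primitive_root (g ^+ q.-1).
  have dvdN : (n %| (q ^ 2).-1)%N by rewrite NE dvdn_mulr.
  by have := dvdn_prim_root rhoP dvdN; rewrite {1}NE mulKn ?(ltnW n1) // exprM.
have g0 : g != 0.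
  by rewrite expf_neq0 // (prim_root_eq0 rhoP) -lt0n NE; nia.
have gqq : g ^+ q ^+ q = g.
  rewrite -exprM mulnn -[(q ^ 2)%N]prednK ?expn_gt0 ?(ltnW q1) // exprSr.
  by rewrite -exprM mulnC exprM (prim_expr_order rhoP) expr1n mul1r.
clearbody g; have frobL (x y : L) : (x + y) ^+ q = x ^+ q + y ^+ q.
  by apply: frobenius_lalg => p; rewrite pchar_lalg.
have [tau tauE] : exists c : K, g + g ^+ q = c%:A.
  by apply: in_base_field; rewrite frobL gqq addrC.
have [nu nuE] : exists c : K, g * g ^+ q = c%:A.
  by apply: in_base_field; rewrite exprMn gqq mulrC.
have g2 : g ^+ 2 = tau *: g - nu%:A.
  by rewrite -nuE -[tau *: g]mulr_algl -tauE; ring.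
have base_dvd m : (exists c : K, g ^+ m = c%:A) <-> (n %| m)%N.
  rewrite (prim_order_dvd zP) exprAC; set x := g ^+ m.
  have x0 : x != 0 by rewrite expf_neq0.
  have xq : x ^+ q = x ^+ q.-1 * x by rewrite -exprSr prednK // ltnW.
  split=> [[c xE]|/eqP x1]; last by apply: in_base_field; rewrite xq x1 mul1r.
  by apply/eqP/(mulIf x0); rewrite -xq mul1r xE base_field_expq.
have g_notK c : g <> c%:A.
  move=> gE; have : (n %| 1)%N by apply/base_dvd; exists c; rewrite expr1.
  by rewrite dvdn1 gtn_eqF.
exists tau, nu; split=> [x|m].
  apply/negP => /eqP x0.
  have : (x%:A - g) * (x%:A - g ^+ q) = 0.
    have -> : (x%:A - g) * (x%:A - g ^+ q) =
       x%:A ^+ 2 - (g + g ^+ q) * x%:A + g * g ^+ q by ring.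
    rewrite tauE nuE -(rmorphXn (in_alg L)) -(rmorphM (in_alg L)).
    by rewrite -(rmorphB (in_alg L)) -(rmorphD (in_alg L)) x0 rmorph0.
  move/eqP; rewrite mulf_eq0 !subr_eq0 => /orP[/eqP/esym/g_notK //|/eqP gq].
  by apply: (@g_notK x); rewrite -[LHS]gqq -gq base_field_expq.
have gm := lucasP m g2; apply/eqP/idP => [y0|/base_dvd[c cE]].
  by apply/base_dvd; exists (lucas tau nu m).1; rewrite gm y0 scale0r addr0.
apply/eqP/negP => /negP y0;
  apply: (@g_notK ((c - (lucas tau nu m).1) / (lucas tau nu m).2)).
apply: (scalerI y0); rewrite scalerA mulrC divfK // scalerBl -cE gm.
by rewrite addrC addKr.
Qed.

End LucasExistence.

(** * A normal basis with the addition formula of the cotangent *)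

Section NormalBasis.

Variables (K : finFieldType) (L : splittingFieldType K).
Variables (sigma : gal_of {:L}) (n : nat).
Local Notation q := #|K|.
Hypotheses (dimL : \dim {:L} = n) (genL : generator 'Gal({:L} / 1) sigma).
Hypotheses (n1 : (1 < n)%N) (n_dvd : (n %| q.+1)%N).

Let galL : galois 1 {:L}. Proof. exact: finField_galois (sub1v _). Qed.

Lemma order_sigma : #[sigma]%g = n.
Proof.
by rewrite orderE -(eqP genL) -(galois_dim galL) dimL dimv1 divn1.
Qed.

Section Homography.

Variables (tau nu : K).
Hypothesis irr : forall x, x ^+ 2 - tau * x + nu != 0.
Hypothesis lucas_dvd : forall m, ((lucas tau nu m).2 == 0) = (n %| m)%N.

(** At a root [theta], Frobenius acts as [theta |-> - nu / (theta + tau)]: this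
    is the action of the multiplication by [g] on [theta = u / v], the ratio of
    the coordinates of [u + v g]. *)
Definition homography_poly : {poly K} := 'X^q * ('X + tau%:P) + nu%:P.

Lemma frobenius_poly (p : {poly K}) : p ^+ q = p \Po 'X^q.
Proof.
elim/poly_ind: p => [|p c IHp].
  by rewrite comp_poly0 expr0n; have := finNzRing_gt1 K; case: #|K|.
rewrite frobenius_lalg; last by move=> x; rewrite pchar_poly.
rewrite exprMn IHp -polyC_exp expf_card comp_polyD comp_polyM comp_polyX.
by rewrite comp_polyC.
Qed.

(** The [m]-th power of Frobenius acts on a root as the homography of [g^m].
    The inductive step raises the congruence to the power [q], multiplies it by
    [X + tau], and replaces [X^q (X + tau)] by [- nu]. *)
Lemma homography_iter m : let: (x, y) := lucas tau nu m in
  homography_poly %|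
    'X^(q ^ m) * (y%:P * 'X + (x + tau * y)%:P) - (x%:P * 'X - (nu * y)%:P).
Proof.
elim: m => [|m IHm].
  by rewrite /= expn0 !mulr0 addr0 mul0r add0r subr0 mulrC subrr dvdp0.
case E: (lucas tau nu m) IHm => [x y] /dvdpP[d dE].
have Em : lucas tau nu m.+1 = (- nu * y, x + tau * y) by rewrite /lucas iterS
  -/(lucas _ _ _) E.
rewrite Em.
have := congr1 (fun p => p ^+ q) dE; rewrite frobenius_poly exprMn.
rewrite !(comp_polyB, comp_polyD, comp_polyM, comp_polyC, comp_polyX, comp_Xn_poly).
have -> : homography_poly ^+ q = homography_poly ^+ q.-1 * homography_poly.
  by rewrite -exprSr prednK // ltnW // finNzRing_gt1.
rewrite -exprM -expnS mulrA; set D := d ^+ q * _ ^+ _; set u := 'X^(q ^ m.+1) => E2.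
have zE : 'X^q * ('X + tau%:P) = homography_poly - nu%:P by rewrite addrK.
apply/dvdpP; exists (('X + tau%:P) * D - (u * y%:P - x%:P)).
rewrite mulrBl -mulrA -E2.
transitivity (('X + tau%:P) * (u * (x + tau * y)%:P + (nu * y)%:P)
  + (u * y%:P - x%:P) * ('X^q * ('X + tau%:P)) - (u * y%:P - x%:P) * homography_poly).
  by rewrite zE !(polyCD, polyCM, polyCN); ring.
by ring.
Qed.

Lemma size_homography_poly : size homography_poly = q.+2.
Proof.
have sz : size ('X^q * ('X + tau%:P) : {poly K}) = q.+2.
  by rewrite size_Mmonic ?monicXaddC ?monic_neq0 ?monicXn // size_polyXn
    size_XaddC addn2.
by rewrite /homography_poly size_polyDl sz // ltnS (leq_trans (size_polyC_leq1 _)).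
Qed.

(** For [m = n] the homography is the identity, so that [homography_poly]
    divides [X^(q^n) - X], which splits over [L]. *)
Lemma exists_homography_root :
  exists theta : L, root (map_poly (in_alg L) homography_poly) theta.
Proof.
have x0n : (lucas tau nu n).1 != 0.
  have := lucas_dvd n.+1; rewrite /= -/(lucas _ _ _).
  have /eqP-> : (lucas tau nu n).2 == 0 by rewrite lucas_dvd.
  rewrite mulr0 addr0 => ->; rewrite -addn1 dvdn_addr // dvdn1.
  by rewrite gtn_eqF.
have := homography_iter n; case E: (lucas tau nu n) x0n => [x y] /= x0.
have /eqP y0 : y == 0 by have := lucas_dvd n; rewrite E /= dvdnn.
rewrite y0 !mulr0 addr0 mul0r add0r subr0 mulrC -mulrBr mul_polyC dvdpZr //.
rewrite -(dvdp_map (in_alg L)) rmorphB /= map_polyXn map_polyX.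
pose FL := FinFieldExtType L.
have cardL : #|FL| = (q ^ n)%N.
  by rewrite -dimL -(@card_vspace K (finvect_type L)) card_vspacef.
rewrite -cardL (finField_genPoly FL) => /dvdp_prod_XsubC[m].
case: (mask m _) => [|theta rs] eqp_F.
  have := eqp_size eqp_F; rewrite big_nil size_poly1 size_map_poly.
  by rewrite size_homography_poly.
exists (theta : L); rewrite (eqp_root eqp_F) root_prod_XsubC.
exact: mem_head.
Qed.

(** Any automorphism [a <> 1] is a power of Frobenius acting as a homography
    whose coefficient [y] is not 0; the relation is obtained by clearing the
    denominator and dividing by [y]. *)
Lemma exists_homography_fixpoint : exists theta : L,
  forall a : gal_of {:L}, a != 1%g -> exists g : K,
    theta * a theta = g *: theta - (tau + g) *: a theta - nu%:A.
Proof.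
have [theta theta_root] := exists_homography_root; exists theta => a a1.
have [alpha gen_alpha alphaE] := finField_galois_generator (sub1v {:L}%AS).
have ord_alpha : #[alpha]%g = n.
  by rewrite orderE -(eqP gen_alpha) -(galois_dim galL) dimL dimv1 divn1.
have alphaXE m x : (alpha ^+ m)%g x = x ^+ (q ^ m).
  elim: m x => [|m IHm] x; first by rewrite gal_id.
  rewrite expgS galM ?memvf // IHm alphaE ?memvf // dimv1 expn1 -exprM.
  by rewrite -expnS.
have [m aE] : exists m, a = (alpha ^+ m)%g.
  have : a \in 'Gal({:L} / 1)%g by rewrite gal_kHom ?sub1v //; apply: k1AHom.
  by rewrite (eqP gen_alpha) => /cycleP.
have ndvd : ~~ (n %| m)%N by rewrite -ord_alpha order_dvdn -aE.
have := homography_iter m; have := lucas_dvd m.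
case: (lucas tau nu m) => x y /= y0 dvdF.
have {}y0 : y != 0 by rewrite y0.
pose A (c : K) : L := c%:A;
  have AM c d : A (c * d) = A c * A d by apply: (rmorphM (in_alg L)).
have AD c d : A (c + d) = A c + A d by apply: (rmorphD (in_alg L)).
have thetaE : a theta * (A y * theta + (A x + A tau * A y)) = A x * theta - A nu
  * A y.
  change (a theta * (y%:A * theta + (x%:A + tau%:A * y%:A)) =
    x%:A * theta - nu%:A * y%:A).
  apply/eqP; rewrite -subr_eq0; apply/eqP.
  have := dvdF; rewrite -(dvdp_map (in_alg L)) => /root_dvdp/(_ theta_root)/rootP.
  rewrite !(rmorphB, rmorphD, rmorphM) /= map_polyXn map_polyX !map_polyC /=.
  by rewrite !hornerE -alphaXE -aE.
exists (x / y); have Ay0 : A y != 0 by rewrite scaler_eq0 oner_eq0 orbF.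
have xE : A (x / y) * A y = A x by rewrite -AM divfK.
rewrite -[(x / y) *: _]mulr_algl -[(tau + _) *: _]mulr_algl.
change (theta * a theta = A (x / y) * theta - A (tau + x / y) * a theta - A nu).
rewrite AD; apply: (mulIf Ay0).
transitivity (a theta * (A y * theta + (A x + A tau * A y))
  - a theta * (A x + A tau * A y)); first by ring.
by rewrite thetaE -xE; ring.
Qed.

End Homography.


Definition galconj i (x : L) : L := (sigma ^+ i)%g x.

Lemma conjD_mod i j x : galconj i (galconj j x) = galconj ((i + j) %% n) x.
Proof.
by rewrite /galconj -order_sigma expg_mod_order addnC expgnDr galM ?memvf.
Qed.

Lemma conj_lin i : linear (galconj i). Proof. by move=> c x y; apply: linearP. Qed.

Lemma conj_base i (c : K) : galconj i c%:A = c%:A.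
Proof. by rewrite /galconj linearZ /= rmorph1. Qed.

Definition trace x : L := \sum_(i < n) galconj i x.

Lemma trace_conj i x : trace (galconj i x) = trace x.
Proof.
have step y : trace (galconj 1 y) = trace y.
  rewrite /trace; case: n n1 conjD_mod => // m _ conjDm.
  rewrite big_ord_recr big_ord_recl /= addrC; congr (_ + _).
    by rewrite conjDm addn1 modnn.
  apply: eq_bigr => k _; rewrite conjDm addn1 modn_small //.
  by have := ltn_ord k; rewrite -ltnS.
elim: i x => [|i IHi] x; first by rewrite /galconj gal_id.
by rewrite -(IHi x) -(step (galconj i x)); congr trace;
  rewrite /galconj -galM ?memvf // expgSr.
Qed.

Lemma trace_lin c x y : trace (c *: x + y) = c *: trace x + trace y.
Proof.
rewrite /trace scaler_sumr -big_split; apply: eq_bigr => i _.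
by rewrite conj_lin.
Qed.

Lemma trace_base (c : K) : trace c%:A = (n%:R * c)%:A.
Proof.
rewrite /trace (eq_bigr (fun=> c%:A)) => [|i _]; last exact: conj_base.
by rewrite sumr_const card_ord mulr_natl scalerMnl.
Qed.

Lemma trace_in_base x : exists c : K, trace x = c%:A.
Proof.
apply/vlineP; rewrite -/1%VS -[1%VS]/(1%AS : {vspace L}) -(galois_fixedField galL).
apply/fixedFieldP; first exact: memvf.
move=> a; rewrite (eqP genL) => /cycleP[i ->].
rewrite /trace raddf_sum; transitivity (trace (galconj i x)); last exact: trace_conj.
apply: eq_bigr => j _; change (galconj i (galconj j x) = galconj j (galconj i x)).
by rewrite !conjD_mod addnC.
Qed.

Lemma n_neq0 : n%:R != 0 :> K.
Proof.
have [d dE] := dvdnP n_dvd; apply/eqP => n0.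
have /eqP := congr1 (fun m => m%:R : K) dE.
by rewrite natrM n0 mulr0 -natr1 natr_card_finField add0r oner_eq0.
Qed.

(** Freeness follows from the trace form: pairing a linear relation between the
    conjugates of [eta] with one of them, and using that the coefficients have
    sum 0 (by taking the trace), leaves [(1 - n b)] times a coefficient. *)
Lemma exists_normal_element : exists (eta : L) (g g' : nat -> K) (delta : K),
  [/\ basis_of {:L} [tuple (sigma ^+ i)%g eta | i < n],
      \sum_(i < n) (sigma ^+ i)%g eta = 1
    & forall i j, (i < n)%N -> (j < n)%N -> i <> j ->
        let m := ((j + n - i) %% n)%N in
        (sigma ^+ i)%g eta * (sigma ^+ j)%g eta =
          g m *: (sigma ^+ i)%g eta + g' m *: (sigma ^+ j)%g eta + delta%:A].
Proof.
have [tau [nu [irr lucas_dvd]]] := exists_lucas n1 n_dvd.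
have [theta thetaP] := exists_homography_fixpoint lucas_dvd.
have sigma_neq1 m : (0 < m < n)%N -> (sigma ^+ m)%g != 1%g.
  move=> /andP[m0 mn]; apply/negP => /eqP s1.
  have : (#[sigma]%g %| m)%N by rewrite order_dvdn s1.
  by rewrite order_sigma gtnNdvd.
(* The translation by [e] makes the trace equal to 1. *)
have [T TE] := trace_in_base theta; pose e := (1 - T) / n%:R.
have neE : n%:R * e = 1 - T by rewrite mulrC divfK ?n_neq0.
clearbody e; pose eta := theta + e%:A.
have tr_eta : trace eta = 1.
  have -> : eta = 1 *: theta + e%:A by rewrite scale1r.
  by rewrite trace_lin TE trace_base neE scale1r -scalerDl addrC subrK scale1r.
pose delta := tau * e - nu - e ^+ 2.
have conj_eta m : galconj m eta = galconj m theta + e%:A.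
  by rewrite -[X in _ = _ + X](conj_base m) /galconj /eta rmorphD.
have relation1 m : exists h, (0 < m < n)%N ->
    eta * galconj m eta = h *: eta + (2%:R * e - tau - h) *: galconj m eta + delta%:A.
  have [mn|] := boolP (0 < m < n)%N; last by exists 0.
  have [h hE] := thetaP _ (sigma_neq1 m mn); exists (h + e) => _.
  rewrite conj_eta /eta; rewrite -/(galconj m theta) in hE.
  move: (galconj m theta) hE => theta'; rewrite /delta.
  have [A [AD [AM [AN [A1 AZ]]]]] : exists A : K -> L,
      {morph A : c d / c + d} /\ {morph A : c d / c * d} /\
      {morph A : c / - c} /\ A 1 = 1 /\ forall c x, c *: x = A c * x.
    exists (in_alg L); do ![split] => [c d|c d|c||c x].
    - exact: rmorphD.
    - exact: rmorphM.
    - exact: rmorphN.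
    - exact: rmorph1.
    - by rewrite mulr_algl.
  rewrite !AZ !mulr1 !(AD, AN, expr2, AM, A1) => hE.
  transitivity (theta * theta' + A e * theta + A e * theta' + A e * A e);
    first by ring.
  by rewrite hE; ring.
have [h hP] := fin_all_exists (fun m : 'I_n => relation1 m).
pose g m := if insub m is Some k then h k else 0.
have gP m : (0 < m < n)%N ->
    eta * galconj m eta = g m *: eta + (2%:R * e - tau - g m) *: galconj m eta +
      delta%:A.
  move=> mn; have [_ lt_mn] := andP mn.
  by rewrite /g insubT /= -[m in galconj m]/(val (Ordinal lt_mn)); apply: hP.
have relation i j : (i < n)%N -> (j < n)%N -> i <> j ->
    let m := ((j + n - i) %% n)%N in
    galconj i eta * galconj j eta =
      g m *: galconj i eta + (2%:R * e - tau - g m) *: galconj j eta + delta%:A.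
  move=> lt_i lt_j ne_ij m.
  have mE : ((i + m) %% n = j)%N.
    by rewrite /m modnDmr subnKC ?modnDr ?modn_small // ltnW // ltn_addl.
  have m_gt0 : (0 < m < n)%N.
    apply/andP; split; last by rewrite ltn_pmod // ltnW.
    rewrite lt0n; apply/eqP => m0.
    by apply: ne_ij; rewrite -mE m0 addn0 modn_small.
  have conj3 a c d x y : galconj i (a *: x + c *: y + d%:A) =
      a *: galconj i x + c *: galconj i y + d%:A.
    by rewrite -addrA !conj_lin conj_base addrA.
  clearbody m; rewrite -mE -conjD_mod -conj3 -gP //.
  by rewrite /galconj rmorphM.
pose b := 2%:R * e - tau + n%:R * delta.
have tr_off i j : (i < n)%N -> (j < n)%N -> i <> j ->
    trace (galconj i eta * galconj j eta) = b%:A.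
  move=> lt_i lt_j ne_ij; rewrite relation //; set m := (_ %% n)%N.
  rewrite -addrA !trace_lin trace_base !trace_conj tr_eta -!scalerDl; congr (_ *: _).
  by rewrite /b; ring.
have tr_sum (I : finType) (P : pred I) (F : I -> L) :
    trace (\sum_(k | P k) F k) = \sum_(k | P k) trace (F k).
  apply: (big_morph trace) => [x y|]; first by have := trace_lin 1 x y;
    rewrite !scale1r.
  by have := trace_base 0; rewrite mulr0 !scale0r.
have tr_diag j : (j < n)%N -> trace (galconj j eta * galconj j eta) = (1 - n%:R *
  b + b)%:A.
  move=> lt_j; have : trace (\sum_(k < n) galconj j eta * galconj k eta) = 1.
    by rewrite -mulr_sumr -/(trace eta) tr_eta mulr1 trace_conj tr_eta.
  rewrite tr_sum (bigD1 (Ordinal lt_j)) //= (eq_bigr (fun=> b%:A)); last first.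
    by move=> k ne_k; apply: tr_off => // jk; case/eqP: ne_k; apply: val_inj.
  rewrite sumr_const cardC1 card_ord => /(canRL (addrK _)) ->.
  transitivity ((1 - b *+ n.-1)%:A : L).
    by rewrite scalerBl scale1r scalerMnl.
  congr (_ *: _).
  have -> : n%:R = n.-1%:R + 1 :> K by rewrite natr1 prednK // ltnW.
  by rewrite -mulr_natl; ring.
(* [1 - n b] is [n^2] times the value of [X^2 - tau X + nu] at
   [- (1 - n e) / n]. *)
have disc : 1 - n%:R * b != 0.
  have n0 := n_neq0; have := irr (- (1 - n%:R * e) / n%:R).
  apply: contra => /eqP b0; apply/eqP; apply: (mulfI (mulf_neq0 n0 n0)).
  rewrite mulr0 -b0 /b /delta; field.
  done.
exists eta, g, (fun m => 2%:R * e - tau - g m), delta; split=> //.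
rewrite basisEfree subvf size_tuple dimL leqnn !andbT.
apply/freeP => c; under eq_bigr
  => k _ do rewrite (nth_map k) ?size_enum_ord // nth_ord_enum -/(galconj k eta).
move=> sum0 j.
have tr0 : trace 0 = 0 by have := trace_base 0; rewrite mulr0 !scale0r.
have trZ a x : trace (a *: x) = a *: trace x by rewrite -[_ *: x]addr0 trace_lin
  tr0 addr0.
have base_inj (a : K) : a%:A = 0 :> L -> a = 0.
  by move/eqP; rewrite scaler_eq0 oner_eq0 orbF => /eqP.
have c0 : \sum_(k < n) c k = 0.
  apply: base_inj; rewrite scaler_suml;
    transitivity (trace (\sum_(k < n) c k *: galconj k eta)).
    rewrite tr_sum; apply: eq_bigr => k _; by rewrite trZ trace_conj tr_eta.
  by rewrite sum0.
have : \sum_(k < n) c k *: trace (galconj j eta * galconj k eta) = 0.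
  transitivity (trace (galconj j eta * \sum_(k < n) c k *: galconj k eta)).
    by rewrite mulr_sumr tr_sum; apply: eq_bigr => k _; rewrite -scalerAr trZ.
  by rewrite sum0 mulr0.
rewrite (bigD1 j) //= tr_diag // (eq_bigr (fun k => (c k * b)%:A)); last first.
  move=> k ne_k; rewrite tr_off ?scalerA // => jk.
  by case/eqP: ne_k; apply: val_inj.
rewrite -scaler_suml -mulr_suml scalerA -scalerDl => /base_inj cj.
move: c0; rewrite (bigD1 j) //= => /eqP; rewrite addrC addr_eq0 => /eqP c0.
move/eqP: cj; rewrite c0 mulrDr mulNr addrK mulf_eq0 (negPf disc) orbF.
by move/eqP.
Qed.

End NormalBasis.

(** * The multiplication of a normal basis *)

Lemma cot_coord_morph (K : fieldType) (V : comNzRingType)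
    (iota : {rmorphism K -> V}) (ev : {rmorphism V -> K}) n g h s d a b k :
  (forall c, ev (iota c) = c) ->
  ev (cot_coord iota n g h s d a b k) =
  cot_coord idfun n g h s d (ev \o a) (ev \o b) k.
Proof.
move=> ev_iota.
have ev_conv c x : ev (conv n (fun i => iota (c i)) x k) =
    conv n (fun i => c i) (ev \o x) k.
  by rewrite rmorph_sum; apply: eq_bigr => j _; rewrite rmorphM ev_iota.
rewrite /cot_coord !(rmorphD, rmorphM, rmorphN) /= !ev_conv ev_iota !rmorph_sum /=.
congr (_ + _ + _ + (_ - _) * _).
  by apply: eq_bigr => j _; rewrite /= rmorphM.
by apply: eq_bigr => j _; rewrite rmorphM.
Qed.

Lemma eq_cot_coord (K : fieldType) (V : comNzRingType)
    (iota : {rmorphism K -> V}) n g h s d (a a' b b' : nat -> V) k :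
  a =1 a' -> b =1 b' ->
  cot_coord iota n g h s d a b k = cot_coord iota n g h s d a' b' k.
Proof.
move=> aE bE; rewrite /cot_coord /conv aE bE;
  congr (_ * _ + _ * _ + _ + (_ * _ - _) * _);
  by apply: eq_bigr => i _; rewrite ?aE ?bE.
Qed.

Section ProductFormula.

Variables (K : fieldType) (L : fieldExtType K) (n : nat).
Variables (E : nat -> L) (g h s : nat -> K) (d : K).
Hypothesis n1 : (1 < n)%N.
Hypothesis sumE : \sum_(i < n) E i = 1.
Hypothesis prodE : forall i j, (i < n)%N -> (j < n)%N -> i <> j ->
  let m := ((j + n - i) %% n)%N in E i * E j = g m *: E i + h m *: E j + d%:A.
Hypothesis sqrE : forall i, (i < n)%N ->
  E i * E i = \sum_(k < n) s ((k + n - i) %% n)%N *: E k.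

Definition left_coef m := if m == 0%N then 0 else g ((n - m) %% n)%N.
Definition right_coef m := if m == 0%N then 0 else h m.

Lemma shift_eq0 i j : (i < n)%N -> (j < n)%N -> (((i + n - j) %% n)%N == 0)%N =
  (i == j).
Proof.
move=> lt_i lt_j; have [le_ji|lt_ij] := leqP j i.
  rewrite -addnBAC // modnDr modn_small; last by lia.
  by rewrite subn_eq0 eqn_leq le_ji andbT.
by rewrite modn_small; lia.
Qed.

Lemma shift_opp i j : (i < n)%N -> (j < n)%N -> i != j ->
  ((n - (i + n - j) %% n) %% n = (j + n - i) %% n)%N.
Proof.
move=> lt_i lt_j ne_ij; have [le_ji|lt_ij] := leqP j i.
  rewrite -[in LHS]addnBAC // [in LHS]modnDr [X in (_ - X)%N]modn_small; last by lia.
  by congr (_ %% _)%N; lia.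
rewrite [X in (_ - X)%N]modn_small; last by lia.
rewrite -[in RHS]addnBAC; last by lia.
by rewrite modnDr; congr (_ %% _)%N; lia.
Qed.

(** The addition formula is extended to [i = j], where its coefficients are 0, at
    the cost of correcting the square by the constant [d]; since the [E k] have
    sum 1, the constants spread equally over all coordinates. *)
Lemma product_formula (a b : nat -> K) :
  (\sum_(i < n) a i *: E i) * (\sum_(j < n) b j *: E j) =
  \sum_(k < n) cot_coord idfun n left_coef right_coef s d a b k *: E k.
Proof.
have pairE (i j : 'I_n) : E i * E j =
    (if i == j then \sum_(k < n) s ((k + n - i) %% n)%N *: E k - d%:A else 0)
    + left_coef ((i + n - j) %% n)%N *: E i + right_coef ((j + n - i) %% n)%N *: E j
    + d%:A.
  rewrite /left_coef /right_coef !shift_eq0 // [j == i :> nat]eq_sym val_eqE.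
  have [<-|ne_ij] := eqVneq; first by rewrite sqrE // !scale0r !addr0 subrK.
  by rewrite prodE ?shift_opp ?add0r //; apply/eqP.
rewrite mulr_suml.
have -> : \sum_(i < n) (a i *: E i) * (\sum_(j < n) b j *: E j) =
    \sum_(i < n) ((a i * b i) *: (\sum_(k < n) s ((k + n - i) %% n)%N *: E k - d%:A)
      + (a i * conv n left_coef b i) *: E i)
    + \sum_(i < n) \sum_(j < n) (b j * (right_coef ((j + n - i) %% n)%N * a i)) *: E j
    + \sum_(i < n) \sum_(j < n) (a i * b j * d)%:A.
  rewrite -!big_split; apply: eq_bigr => i _ /=.
  rewrite mulr_sumr (eq_bigr (fun j : 'I_n => (a i * b j) *: (if i == j then
      \sum_(k < n) s ((k + n - i) %% n)%N *: E k - d%:A else 0)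
    + (a i * (left_coef ((i + n - j) %% n)%N * b j)) *: E i
    + (b j * (right_coef ((j + n - i) %% n)%N * a i)) *: E j
    + (a i * b j * d)%:A)); last first.
    move=> j _; rewrite -scalerAl -scalerAr scalerA pairE !scalerDr !scalerA.
    by congr (_ + _ *: _ + _ *: _ + _); ring.
  rewrite !big_split /=; congr (_ + _ + _ + _).
    rewrite (bigD1 i) //= eqxx [X in _ + X]big1 ?addr0 // => j.
    by rewrite eq_sym => /negPf->; rewrite scaler0.
  by rewrite -scaler_suml /conv mulr_sumr.
rewrite [X in _ + X + _]exchange_big /=.
have -> : \sum_(i < n) \sum_(j < n) (a i * b j * d)%:A =
   \sum_(k < n) ((\sum_(i < n) a i) * (\sum_(i < n) b i) * d) *: E k :> L.
  rewrite -scaler_sumr sumE mulr_suml mulr_suml scaler_suml.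
  apply: eq_bigr => i _; rewrite mulr_sumr mulr_suml scaler_suml.
  by apply: eq_bigr => j _.
rewrite big_split /=.
have -> : \sum_(i < n) (a i * b i) *:
      (\sum_(k < n) s ((k + n - i) %% n)%N *: E k - d%:A) =
   \sum_(k < n) (conv n s (fun i => a i * b i) k
      - (\sum_(i < n) a i * b i) * d) *: E k.
  under [RHS]eq_bigr => k _ do rewrite scalerBl.
  under [LHS]eq_bigr => i _ do rewrite scalerBr.
  rewrite !sumrB; congr (_ - _).
    under [LHS]eq_bigr => i _ do rewrite scaler_sumr.
    rewrite exchange_big /=; apply: eq_bigr => k _.
    by rewrite /conv scaler_suml; apply: eq_bigr => i _; rewrite scalerA mulrC.
  rewrite -scaler_sumr sumE mulr_suml scaler_suml.
  by apply: eq_bigr => i _; rewrite scalerA.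
rewrite -!big_split; apply: eq_bigr => k _ /=.
rewrite -scaler_suml -!scalerDl -mulr_sumr /cot_coord /conv /=; congr (_ *: _).
by ring.
Qed.

End ProductFormula.

(** * From known values to straight-line programs *)

Section Compile.

Variables (K : fieldType) (V : comNzRingType) (iota : {rmorphism K -> V}).
Variables (X : Type) (ev : X -> {rmorphism V -> K}).
Hypothesis ev_iota : forall x c, ev x (iota c) = c.

(** Evaluating the known values at a point is a ring morphism, so it turns each
    step into an instruction; the register of a value is its index. *)
Lemma compile_step S v : step iota S v ->
  exists i, instr_wf (size S) i /\ forall x, exec (map (ev x) S) i = ev x v.
Proof.
have idx a : a \in S -> (index a S < size S)%N /\
    forall x, (map (ev x) S)`_(index a S) = ev x a.
  by move=> aS; rewrite index_mem; split=> // x;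
    rewrite (nth_map 0) ?index_mem ?nth_index.
case=> [a c|a c|a c|a b|a b|a b] /idx[wfa aE].
- by exists (AddC (index a S) c); split=> // x; rewrite /= aE rmorphD ev_iota.
- by exists (SubC (index a S) c); split=> // x; rewrite /= aE rmorphB ev_iota.
- by exists (MulC (index a S) c); split=> // x; rewrite /= aE rmorphM ev_iota.
- move=> /idx[wfb bE]; exists (Defs.Add K (index a S) (index b S)).
  by split=> [|x]; rewrite /= ?wfa // aE bE rmorphD.
- move=> /idx[wfb bE]; exists (Defs.Sub K (index a S) (index b S)).
  by split=> [|x]; rewrite /= ?wfa // aE bE rmorphB.
- move=> /idx[wfb bE]; exists (Defs.Mul K (index a S) (index b S)).
  by split=> [|x]; rewrite /= ?wfa // aE bE rmorphM.
Qed.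

Lemma code_wf_cat m (c1 c2 : seq (instr K)) :
  code_wf m (c1 ++ c2) = code_wf m c1 && code_wf (m + size c1) c2.
Proof.
elim: c1 m => [|i c1 IHc] m /=; first by rewrite addn0.
by rewrite IHc andbA addSnnS.
Qed.

Lemma grows_size c S S' : grows iota c S S' -> size S' = (size S + c)%N.
Proof.
by elim=> [S0|c0 S0 S1 v _ IH _]; rewrite ?addn0 // size_rcons IH addnS.
Qed.

Lemma compile_grows c S S' : grows iota c S S' ->
  exists code : seq (instr K), [/\ size code = c, code_wf (size S) code
    & forall x, run code (map (ev x) S) = map (ev x) S'].
Proof.
elim=> [S0|c0 S0 S1 v g [code [szc wfc runE]] st]; first by exists [::].
have [i [wfi iE]] := compile_step st; exists (rcons code i); split.
- by rewrite size_rcons szc.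
- by rewrite -cats1 code_wf_cat wfc /= szc -(grows_size g) wfi.
- move=> x; rewrite -cats1 /run foldl_cat; have := runE x; rewrite /run => ->.
  by rewrite /= iE map_rcons.
Qed.

Lemma compile_reaches c S (out : seq V) :
  reaches iota c S (fun S' => {subset out <= S'}) ->
  exists P : slp K, [/\ (slp_cost P <= c)%N, slp_wf (size S) P
    & forall x, slp_eval P (map (ev x) S) = map (ev x) out].
Proof.
move=> [c' [S' [le_c g outS']]]; have [code [szc wfc runE]] := compile_grows g.
exists (Slp code [seq index v S' | v <- out]); split.
- by rewrite /slp_cost szc.
- rewrite /slp_wf wfc /= szc -(grows_size g); apply/allP => r /mapP[v v_out ->].
  by rewrite index_mem; apply: outS'.
- move=> x; rewrite /slp_eval runE -map_comp; apply/eq_in_map => v v_out /=.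
  by rewrite (nth_map 0) ?index_mem ?nth_index //; apply: outS'.
Qed.

End Compile.

(** A copy of the type of functions, which can be given the structure of a
    nonzero ring as its domain is never empty. *)
Definition funring (K : finFieldType) (m : nat) : Type := {ffun m.-tuple K -> K}.

Section FunRing.

Variables (K : finFieldType) (m : nat).

HB.instance Definition _ := GRing.PzRing.on (funring K m).

Fact funring_mulC : @commutative (funring K m) _ *%R.
Proof. exact: ffun_mulC. Qed.

Fact funring_nonzero : 1 != 0 :> funring K m.
Proof. exact: ffun1_nonzero [tuple 0 | i < m]. Qed.

HB.instance Definition _ :=
  GRing.PzRing_hasCommutativeMul.Build (funring K m) funring_mulC.
HB.instance Definition _ :=
  GRing.PzSemiRing_isNonZero.Build (funring K m) funring_nonzero.

Definition fun_const (c : K) : funring K m := [ffun=> c].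
Definition fun_eval (t : m.-tuple K) (f : funring K m) : K := f t.
Definition fun_input (i : nat) : funring K m := [ffun t : m.-tuple K => t`_i].

Fact fun_const_additive : zmod_morphism fun_const.
Proof. by move=> c d; apply/ffunP => t; rewrite !ffunE. Qed.
Fact fun_const_multiplicative : monoid_morphism fun_const.
Proof. by split=> [|c d]; apply/ffunP => t; rewrite !ffunE. Qed.
HB.instance Definition _ :=
  GRing.isZmodMorphism.Build K (funring K m) fun_const fun_const_additive.
HB.instance Definition _ :=
  GRing.isMonoidMorphism.Build K (funring K m) fun_const fun_const_multiplicative.

Fact fun_eval_additive t : zmod_morphism (fun_eval t).
Proof. by move=> f g; rewrite /fun_eval !ffunE. Qed.
Fact fun_eval_multiplicative t : monoid_morphism (fun_eval t).
Proof. by split=> [|f g]; rewrite /fun_eval !ffunE. Qed.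
HB.instance Definition _ t :=
  GRing.isZmodMorphism.Build (funring K m) K (fun_eval t) (fun_eval_additive t).
HB.instance Definition _ t :=
  GRing.isMonoidMorphism.Build (funring K m) K (fun_eval t)
    (fun_eval_multiplicative t).

Definition fun_inputs : seq (funring K m) := [seq fun_input i | i <- seq.iota 0 m].

Lemma eval_inputs (t : m.-tuple K) : map (fun_eval t) fun_inputs = t.
Proof.
apply: (@eq_from_nth _ 0); rewrite !size_map size_iota ?size_tuple // => i lt_i.
rewrite -map_comp (nth_map 0%N) ?size_iota // nth_iota //=.
by rewrite /fun_eval ffunE.
Qed.

End FunRing.

Section NormalBasisCost.

Variables (K : finFieldType) (L : splittingFieldType K).
Variables (sigma : gal_of {:L}) (n : nat).
Hypotheses (dimL : \dim {:L} = n) (genL : generator 'Gal({:L} / 1) sigma).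
Hypotheses (n1 : (1 < n)%N) (n_dvd : (n %| #|K|.+1)%N).

(** The coordinates of the square of a conjugate are those of the square of
    [eta], shifted cyclically. *)
Lemma sqr_conj (eta : L) (s : nat -> K) i : (i < n)%N ->
  eta * eta = \sum_(m < n) s m *: galconj sigma m eta ->
  galconj sigma i eta * galconj sigma i eta =
    \sum_(k < n) s ((k + n - i) %% n)%N *: galconj sigma k eta.
Proof.
move=> lt_i sqr; have n0 : (0 < n)%N := ltnW n1.
rewrite -[LHS]/((sigma ^+ i)%g eta * (sigma ^+ i)%g eta) -rmorphM sqr raddf_sum /=.
pose shift (m : 'I_n) := Ordinal (ltn_pmod (i + m) n0).
pose unshift (k : 'I_n) := Ordinal (ltn_pmod (k + n - i) n0).
have shiftK k : shift (unshift k) = k.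
  apply: val_inj; rewrite /= modnDmr subnKC ?modnDr ?modn_small //.
  by rewrite ltnW // ltn_addl.
have unshiftK m : unshift (shift m) = m.
  apply: val_inj; rewrite /= -addnBA ?(ltnW lt_i) // modnDml.
  have -> : (i + m + (n - i) = m + n)%N by lia.
  by rewrite modnDr modn_small.
rewrite (reindex unshift) /=; last by exists shift => k _.
apply: eq_bigr => k _; rewrite linearZ /=; congr (_ *: _).
rewrite -[LHS]/(galconj sigma i (galconj sigma (unshift k) eta)) (conjD_mod dimL
  genL).
by rewrite -[in RHS](shiftK k).
Qed.

Lemma exists_cheap_normal_basis : exists (Theta : n.-tuple L) (P : slp K),
  [/\ is_normal_basis sigma Theta, computes_product Theta P
    & (slp_cost P <= cot_cost n)%N].
Proof.
have n0 : (0 < n)%N := ltnW n1.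
have [eta [g [g' [delta [basisT sumT prodT]]]]] :=
  exists_normal_element dimL genL n1 n_dvd.
set Theta := [tuple _ | i < n] in basisT; pose E i := galconj sigma i eta.
have ThetaE (i : 'I_n) : Theta`_i = E i by rewrite -tnth_nth tnth_mktuple.
have freeT := basis_free basisT.
have coordE (x : L) : x = \sum_(i < n) coord Theta i x *: E i.
  rewrite {1}(coord_basis basisT (memvf x)).
  by apply: eq_bigr => i _; rewrite ThetaE.
pose s m := (coords Theta (eta * eta))`_m.
have coords_nth x (i : 'I_n) : (coords Theta x)`_i = coord Theta i x.
  by rewrite /coords (nth_map i) ?size_enum_ord // nth_ord_enum.
have sqrT i : (i < n)%N ->
    E i * E i = \sum_(k < n) s ((k + n - i) %% n)%N *: E k.
  move=> lt_i; apply: sqr_conj lt_i _; rewrite {1}(coordE (eta * eta)).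
  by apply: eq_bigr => m _; rewrite /s coords_nth.
have formula := product_formula n1 sumT prodT sqrT.
set G := left_coef n g in formula; set H := right_coef g' in formula.
pose V := funring K (n + n)%N; pose C : {rmorphism K -> V} := @fun_const K (n + n)%N.
pose A i : V := fun_input K (n + n)%N i;
  pose B i : V := fun_input K (n + n)%N (n + i)%N.
have inA j : (j < n)%N -> A j \in fun_inputs K (n + n)%N.
  by move=> lt_j; apply: map_f; rewrite mem_iota add0n ltn_addr.
have inB j : (j < n)%N -> B j \in fun_inputs K (n + n)%N.
  by move=> lt_j; apply: map_f; rewrite mem_iota add0n ltn_add2l.
have evC (t : (n + n).-tuple K) c : fun_eval t (C c) = c by rewrite /fun_eval ffunE.
pose out := [seq cot_coord C n G H s delta A B k | k <- seq.iota 0 n].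
have reach_out : reaches C (cot_cost n) (fun_inputs K (n + n)%N)
    (fun S' => {subset out <= S'}).
  apply: reaches_weaken (leqnn _) _ (reaches_cot_coord C G H s delta n0 inA inB).
  move=> S' _ outS' v /mapP[k]; rewrite mem_iota => /andP[_ lt_k] ->; exact: outS'.
have [P [costP wfP evalP]] := compile_reaches (ev := @fun_eval K (n + n)%N) evC
  reach_out.
exists Theta, P; split=> //.
  split=> //; exists eta => //; apply/eqP => eta0.
  have := congr1 (fun x : L => x) sumT; rewrite big1 => [/esym/eqP|i _].
    by rewrite oner_eq0.
  by rewrite eta0 rmorph0.
split=> [|a b]; first by move: wfP; rewrite size_map size_iota.
have size_coords x : size (coords Theta x) = n by rewrite size_map size_enum_ord.
have sz : size (coords Theta a ++ coords Theta b) = (n + n)%N.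
  by rewrite size_cat !size_coords.
pose t : (n + n).-tuple K := tcast sz (in_tuple (coords Theta a ++ coords Theta b)).
have tE : t = coords Theta a ++ coords Theta b :> seq K by rewrite val_tcast.
rewrite -tE -(eval_inputs t) evalP.
have fst_t (i : 'I_n) : t`_i = coord Theta i a.
  by rewrite tE nth_cat size_coords ltn_ord coords_nth.
have snd_t (i : 'I_n) : t`_(n + i)%N = coord Theta i b.
  by rewrite tE nth_cat size_coords ltnNge leq_addr addKn coords_nth.
have abE : a * b = \sum_(k < n) cot_coord idfun n G H s delta
    (fun i => t`_i) (fun i => t`_(n + i)%N) k *: Theta`_k.
  transitivity ((\sum_(i < n) t`_i *: E i) * (\sum_(j < n) t`_(n + j)%N *: E j)).
    by rewrite {1}(coordE a) {1}(coordE b); congr (_ * _);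
      apply: eq_bigr => i _; rewrite ?fst_t ?snd_t.
  rewrite (formula (fun i => t`_i) (fun i => t`_(n + i)%N)).
  by apply: eq_bigr => k _; rewrite ThetaE.
rewrite /out -map_comp -val_enum_ord -map_comp; apply: eq_map => k /=.
rewrite abE coord_sum_free // (cot_coord_morph _ _ _ _ _ _ _ _ (evC t)).
by apply: eq_cot_coord => i; rewrite /= /fun_eval ffunE.
Qed.

End NormalBasisCost.

(** * The asymptotic bound *)

Section Asymptotics.

Variable R : realType.

Lemma ln2_lt1 : ln 2%:R < 1 :> R.
Proof.
by rewrite -ltr_expR lnK ?posrE // -[2%:R]/(1 + 1) expR_gt1Dx // oner_eq0.
Qed.

Lemma ln3_gt1 : 1 < ln 3%:R :> R.
Proof.
have ge6 : 1 / 6%:R <= ln (6%:R / 5%:R) :> R.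
  have := @le_ln1Dx R (- (1 / 6%:R));
    have -> : 1 + - (1 / 6%:R) = (6%:R / 5%:R)^-1 :> R.
    by field.
  by rewrite lnV ?posrE ?divr_gt0 // lerN2; apply; lra.
have lt3 : (6%:R / 5%:R) ^+ 6 < 3%:R :> R by lra.
have : ln ((6%:R / 5%:R) ^+ 6) < ln 3%:R :> R by rewrite ltr_ln ?posrE ?exprn_gt0
  ?divr_gt0.
rewrite lnXn ?divr_gt0 //; move: ge6; move: (ln _) (ln _) => u v.
by lra.
Qed.

Let D : R := `|ln (ln 2%:R)|.
Let kappa : R := ln (ln 3%:R).

Lemma D_gt0 : 0 < D.
Proof.
have l2 : 0 < ln 2%:R :> R by rewrite ln_gt0 // ltr1n.
by rewrite /D normr_gt0 ln_eq0 // lt_eqF // ln2_lt1.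
Qed.

Lemma kappa_gt0 : 0 < kappa.
Proof. by rewrite /kappa ln_gt0 // ln3_gt1. Qed.

(** The function [ln n * |ln |ln n||] vanishes for no integer [n >= 2], but
    [ln 2 < 1 < ln 3], so that [n = 2] is treated apart: for [n >= 3] the
    iterated logarithm is at least [ln (ln 3) > 0], which absorbs the additive
    constants. *)
Lemma load_le_loglog : exists C : R, 0 < C /\ forall n x : nat,
  (1 < n)%N -> (0 < x)%N -> (2 ^ x <= n)%N ->
  (x * (trunc_log 2 x).+1)%:R <= C * (ln n%:R * `|ln `|ln n%:R| |).
Proof.
have l2 : 0 < ln 2%:R :> R by rewrite ln_gt0 // ltr1n.
have D0 := D_gt0; have k0 := kappa_gt0.
pose c2 : R := (ln 2%:R)^-1; pose c3 : R := c2 + (1 + c2 * D) / kappa.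
have c20 : 0 < c2 by rewrite invr_gt0.
have c30 : 0 < c3.
  by rewrite addr_gt0 // divr_gt0 // addr_gt0 // mulr_gt0.
exists (c2 * (D^-1 + c3)); split; first by rewrite mulr_gt0 // addr_gt0 ?invr_gt0.
move=> n x n1 x0 le_xn; set l := trunc_log 2 x.
have n0 : 0 < n%:R :> R by rewrite ltr0n ltnW.
have lnn0 : 0 < ln n%:R :> R by rewrite ln_gt0 // ltr1n.
have le_x : x%:R <= c2 * ln n%:R :> R.
  rewrite mulrC ler_pdivlMr // mulr_natl -lnXn // ler_ln ?posrE ?exprn_gt0 //.
  by rewrite -natrX ler_nat.
rewrite natrM -mulrA mulrCA [X in _ <= X]mulrCA mulrA -[X in _ <= X]mulrA.
rewrite [X in _ <= X](_ : _ = (c2 * ln n%:R) * ((D^-1 + c3) * `|ln `|ln n%:R|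
  |)); last by ring.
apply: ler_pM => //.
have [n_eq2|n_neq2] := eqVneq n 2.
  have x1 : x = 1%N.
    by have := leq_ltn_trans le_xn (_ : n < 2 ^ 2)%N;
      rewrite n_eq2 ltn_exp2l // => /(_ isT); lia.
  have -> : l.+1 = 1%N by rewrite /l x1.
  rewrite n_eq2 [`|ln 2%:R|]gtr0_norm // -/D mulrDl mulVf ?gt_eqF //.
  by rewrite lerDl mulr_ge0 // ltW.
have n3 : (3 <= n)%N by lia.
have le_ln3 : ln 3%:R <= ln n%:R :> R by rewrite ler_ln ?posrE ?ler_nat.
have le_kappa : kappa <= ln (ln n%:R).
  by rewrite /kappa ler_ln ?posrE // (lt_trans _ ln3_gt1).
have lnln0 : 0 < ln (ln n%:R) :> R by apply: lt_le_trans le_kappa.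
rewrite [`|ln n%:R|]gtr0_norm // gtr0_norm //;
  set y := ln (ln n%:R) in le_kappa lnln0 *.
have le_l : l%:R <= c2 * (y + D).
  have le_lx : (2 ^ l <= x)%N by apply: trunc_logP.
  rewrite mulrC ler_pdivlMr // mulr_natl -lnXn //.
  apply: (@le_trans _ _ (ln (c2 * ln n%:R))).
    rewrite ler_ln ?posrE ?exprn_gt0 ?mulr_gt0 //; apply: le_trans le_x.
    by rewrite -natrX ler_nat.
  rewrite lnM ?posrE // lnV ?posrE // addrC lerD2l /D -normrN.
  exact: ler_norm.
rewrite -natr1 mulrDl; apply: (@le_trans _ _ (c3 * y));
  last by rewrite lerDr mulr_ge0 // ltW // invr_gt0.
have : (1 + c2 * D) <= (1 + c2 * D) / kappa * y.
  have ge1 : 1 <= kappa^-1 * y by rewrite mulrC ler_pdivlMr // mul1r.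
  by rewrite -mulrA ler_peMr // addr_ge0 // mulr_ge0 // ltW.
rewrite /c3 mulrDl; move: le_l; rewrite mulrDr; lra.
Qed.

End Asymptotics.

Definition cost_factor := (3 * (100 * 3 ^ 7 * 6) + 19)%N.

Lemma cot_cost_le n : (0 < n)%N ->
  (cot_cost n <= cost_factor * (n * load (up_log 2 (n + n))))%N.
Proof.
move=> n0; rewrite /cot_cost /conv_cost /mul_load /cost_factor.
have := load_gt0 (up_log 2 (n + n)); set l := load _ => l0.
have le_n : (n <= n * l)%N by rewrite leq_pmulr.
move: (100 * 3 ^ 7)%N => A.
have -> : (A * (3 * (n + n)) * l = A * 6 * (n * l))%N by ring.
rewrite mulnDl -[(3 * _ * _)%N]mulnA.
by move: le_n; move: (n * l)%N => v; move: (A * 6 * v)%N => u; lia.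
Qed.

Lemma load_exponent n : (1 < n)%N -> (2 ^ maxn 1 (up_log 2 (n + n) - 4) <= n)%N.
Proof.
move=> n1; set k := up_log 2 (n + n).
have n2 : (1 < n + n)%N by lia.
have /andP[lt_k _] := up_log_bounds (isT : (1 < 2)%N) n2.
have [le_k|lt_k4] := leqP k 5.
  by have -> : maxn 1 (k - 4) = 1%N by lia.
have le_xk : (maxn 1 (k - 4) <= k.-2)%N by lia.
apply: leq_trans (leq_pexp2l (isT : (0 < 2)%N) le_xk) _.
have powE : (2 ^ k.-1 = 2 * 2 ^ k.-2)%N by rewrite -expnS; congr (_ ^ _)%N; lia.
by move: lt_k; rewrite -/k powE; lia.
Qed.

(** A least cost exists by excluded middle. *)
Lemma exists_complexity (K : fieldType) (L : fieldExtType K) n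
    (Theta : n.-tuple L) (P : slp K) : computes_product Theta P ->
  exists c, is_complexity Theta c /\ (c <= slp_cost P)%N.
Proof.
move=> prodP.
pose attained c := `[< exists2 P, computes_product Theta P & slp_cost P = c >].
have exP : exists c, attained c by exists (slp_cost P); apply/asboolP; exists P.
case: (ex_minnP exP) => c /asboolP cP c_min; exists c; split; last first.
  by apply: c_min; apply/asboolP; exists P.
by split=> // P' prodP'; apply: c_min; apply/asboolP; exists P'.
Qed.

Theorem theorem1p3 (R : realType) :
  exists C : R,
    forall (q n : nat) (K : finFieldType) (L : splittingFieldType K)
      (sigma : gal_of {:L}),
      #|K| = q ->
      \dim {:L} = n ->
      generator 'Gal({:L} / 1) sigma ->
      (n %| q.+1)%N ->
      (1 < n < q.+1)%N ->
      exists (Theta : n.-tuple L) (c : nat),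
        [/\ is_normal_basis sigma Theta,
            is_complexity Theta c
          & c%:R <= C * (n%:R * ln n%:R * `|ln `|ln n%:R| |)].
Proof.
have [C1 [C10 loadC]] := load_le_loglog R.
exists (cost_factor%:R * C1) => q n K L sigma <- dimL genL n_dvd /andP[n1 _].
have [Theta [P [normalT prodP costP]]] := exists_cheap_normal_basis dimL genL n1
  n_dvd.
have [c [cP le_c]] := exists_complexity prodP.
exists Theta, c; split=> //.
have le_cost := leq_trans (leq_trans le_c costP) (cot_cost_le (ltnW n1)).
apply: le_trans (_ : (cost_factor * (n * load (up_log 2 (n + n))))%N%:R <= _).
  by rewrite ler_nat.
rewrite !natrM -!mulrA ler_wpM2l //.
rewrite [X in _ <= X]mulrCA ler_wpM2l //.
rewrite -natrM; apply: loadC => //; [by rewrite leq_max | exact: load_exponent].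
Qed.
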